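(* Let $\Lambda$ be an artin algebra, $n$ a positive integer, $\mathcal{M}$ an $n$-cluster tilting subcategory of $\mathrm{mod}\text{-}\Lambda$, and $A\in\mathcal{M}$. (i) If $F$ is a direct summand of $\mathrm{Ext}^n_\Lambda(A,-)|_{\mathcal{M}}$, then there exists $B\in\mathcal{M}$ such that $F\simeq\mathrm{Ext}^n_\Lambda(B,-)|_{\mathcal{M}}$. (ii) If $F$ is a direct summand of $\mathrm{Ext}^n_\Lambda(-,A)|_{\mathcal{M}}$, then there exists $B\in\mathcal{M}$ such that $F\simeq\mathrm{Ext}^n_\Lambda(-,B)|_{\mathcal{M}}$.
   Context: $\mathrm{mod}\text{-}\Lambda$ is the category of finitely generated $\Lambda$-modules. A full additive subcategory $\mathcal{M}$ of $\mathrm{mod}\text{-}\Lambda$ is $n$-cluster tilting if it is functorially finite (every module has a right and a left $\mathcal{M}$-approximation), generating-cogenerating (every module is a quotient of an object of $\mathcal{M}$ and embeds in an object of $\mathcal{M}$), and $$\mathcal{M}=\{A: \mathrm{Ext}^i_\Lambda(\mathcal{M},A)=0,\ 0<i<n\}=\{A: \mathrm{Ext}^i_\Lambda(A,\mathcal{M})=0,\ 0<i<n\}.$$ $|_{\mathcal{M}}$ denotes restriction of a functor on $\mathrm{mod}\text{-}\Lambda$ to $\mathcal{M}$; direct summands are taken in the category of additive functors $\mathcal{M}\to\mathrm{Ab}$ (covariant in (i), contravariant in (ii)). *)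

(* Defs.v *)
From HB Require Import structures.
From mathcomp Require Import all_boot all_order all_algebra.
From mathcomp Require Import finmap boolp classical_sets functions cardinality.
From mathcomp Require Import fsbigop.

Set Implicit Arguments.
Unset Strict Implicit.
Unset Printing Implicit Defensive.
Import GRing.Theory.
Local Open Scope classical_set_scope.
Local Open Scope ring_scope.

(* Preadditive categories.  Composition is in diagrammatic order:
   [hcomp f g] is "first f, then g". *)

Record preadditive := Preadditive {
  ob :> Type;
  hom : ob -> ob -> zmodType;
  idm : forall X, hom X X;
  hcomp : forall X Y Z, hom X Y -> hom Y Z -> hom X Z;
  comp1f : forall X Y (f : hom X Y), hcomp (idm X) f = f;
  compf1 : forall X Y (f : hom X Y), hcomp f (idm Y) = f;
  compA : forall X Y Z W (f : hom X Y) (g : hom Y Z) (h : hom Z W),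
    hcomp f (hcomp g h) = hcomp (hcomp f g) h;
  compDl : forall X Y Z (f g : hom X Y) (h : hom Y Z),
    hcomp (f + g) h = hcomp f h + hcomp g h;
  compDr : forall X Y Z (f : hom X Y) (g h : hom Y Z),
    hcomp f (g + h) = hcomp f g + hcomp f h }.

Definition opcat (C : preadditive) : preadditive :=
  @Preadditive C (fun X Y => hom Y X) (@idm C) (fun X Y Z f g => hcomp g f)
    (fun X Y f => compf1 f) (fun X Y f => comp1f f)
    (fun X Y Z W f g h => esym (compA h g f))
    (fun X Y Z f g h => compDr h f g) (fun X Y Z f g h => compDl g h f).

Definition fullsub (C : preadditive) (P : C -> Prop) : preadditive :=
  @Preadditive {X : C | P X} (fun X Y => hom (sval X) (sval Y))
    (fun X => idm (sval X)) (fun X Y Z f g => hcomp f g)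
    (fun X Y f => comp1f f) (fun X Y f => compf1 f)
    (fun X Y Z W f g h => compA f g h)
    (fun X Y Z f g h => compDl f g h) (fun X Y Z f g h => compDr f g h).

Definition is_biproduct (C : preadditive) (X Y Z : C) : Prop :=
  exists (i1 : hom X Z) (i2 : hom Y Z) (p1 : hom Z X) (p2 : hom Z Y),
    [/\ hcomp i1 p1 = idm X, hcomp i2 p2 = idm Y, hcomp i1 p2 = 0,
        hcomp i2 p1 = 0 & hcomp p1 i1 + hcomp p2 i2 = idm Z].

Definition additive_category (C : preadditive) : Prop :=
  (exists Z : C, idm Z = 0) /\ (forall X Y : C, exists Z : C, is_biproduct X Y Z).

(* Additive functors from [C] to abelian groups; the contravariant ones are
   the [functor (opcat C)]. *)

Record functor (C : preadditive) := Functor {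
  fob :> C -> zmodType;
  fmap : forall X Y : C, hom X Y -> {additive fob X -> fob Y};
  fmap1 : forall (X : C) (x : fob X), fmap (idm X) x = x;
  fmapM : forall (X Y Z : C) (f : hom X Y) (g : hom Y Z) (x : fob X),
    fmap (hcomp f g) x = fmap g (fmap f x);
  fmapD : forall (X Y : C) (f g : hom X Y) (x : fob X),
    fmap (f + g) x = fmap f x + fmap g x }.

Record nattrans (C : preadditive) (F G : functor C) := NatTrans {
  ncomp :> forall X : C, {additive F X -> G X};
  nnat : forall (X Y : C) (f : hom X Y) (x : F X),
    ncomp Y (fmap F f x) = fmap G f (ncomp X x) }.

Definition funct_iso (C : preadditive) (F G : functor C) : Prop :=
  exists (s : nattrans F G) (t : nattrans G F),
    forall X : C, cancel (s X) (t X) /\ cancel (t X) (s X).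

Section DirectSum.
Variables (C : preadditive) (F G : functor C).

Definition dsum_map (X Y : C) (f : hom X Y) (u : (F X * G X)%type) :
  (F Y * G Y)%type := (fmap F f u.1, fmap G f u.2).

Lemma dsum_map_additive X Y f : zmod_morphism (@dsum_map X Y f).
Proof. by move=> u v; rewrite /dsum_map /= !raddfB. Qed.

HB.instance Definition _ X Y f :=
  GRing.isZmodMorphism.Build _ _ (@dsum_map X Y f) (@dsum_map_additive X Y f).

Lemma dsum_map1 X u : dsum_map (idm X) u = u.
Proof. by case: u => x y; rewrite /dsum_map /= !fmap1. Qed.

Lemma dsum_mapM X Y Z (f : hom X Y) (g : hom Y Z) u :
  dsum_map (hcomp f g) u = dsum_map g (dsum_map f u).
Proof. by rewrite /dsum_map /= !fmapM. Qed.

Lemma dsum_mapD X Y (f g : hom X Y) u :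
  dsum_map (f + g) u = dsum_map f u + dsum_map g u.
Proof. by rewrite /dsum_map !fmapD. Qed.

Definition dsum : functor C :=
  @Functor C (fun X => (F X * G X)%type : zmodType)
    (fun X Y f => dsum_map f : {additive _ -> _}) dsum_map1 dsum_mapM dsum_mapD.

End DirectSum.

Definition direct_summand (C : preadditive) (F G : functor C) : Prop :=
  exists F' : functor C, funct_iso (dsum F F') G.

Definition restrict (C : preadditive) (P : C -> Prop) (F : functor C) :
  functor (fullsub P) :=
  @Functor (fullsub P) (fun X => F (sval X)) (fun X Y f => fmap F f)
    (fun X => @fmap1 C F (sval X)) (fun X Y Z => @fmapM C F _ _ _)
    (fun X Y => @fmapD C F _ _).

Definition restrict_op (C : preadditive) (P : C -> Prop) (F : functor (opcat C)) :
  functor (opcat (fullsub P)) :=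
  @Functor (opcat (fullsub P)) (fun X => F (sval X))
    (fun X Y (f : hom (sval Y) (sval X)) => @fmap (opcat C) F (sval X) (sval Y) f)
    (fun X => @fmap1 (opcat C) F (sval X)) (fun X Y Z => @fmapM (opcat C) F _ _ _)
    (fun X Y => @fmapD (opcat C) F _ _).

Section HomGroup.
Variables (L : pzRingType) (U V : lmodType L).

Definition Hom := {linear U -> V}.

HB.instance Definition _ := gen_eqMixin Hom.
HB.instance Definition _ := gen_choiceMixin Hom.

Lemma HomP (f g : Hom) : (forall x, f x = g x) -> f = g.
Proof.
case: f => f [[f0] [f1]]; case: g => g [[g0] [g1]] /= fg.
have e : f = g by apply: funext.
rewrite -e in g0 g1 *.
by rewrite (Prop_irrelevance g0 f0) (Prop_irrelevance g1 f1).
Qed.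

Definition Hom0 : Hom := \0 : {linear U -> V}.
Definition HomD (f g : Hom) : Hom := f \+ g : {linear U -> V}.
Definition HomN (f : Hom) : Hom := \- f : {linear U -> V}.

Lemma HomDA : associative HomD.
Proof. by move=> f g h; apply: HomP => x /=; rewrite addrA. Qed.
Lemma HomDC : commutative HomD.
Proof. by move=> f g; apply: HomP => x /=; rewrite addrC. Qed.
Lemma Hom0D : left_id Hom0 HomD.
Proof. by move=> f; apply: HomP => x /=; rewrite add0r. Qed.
Lemma HomND : left_inverse Hom0 HomN HomD.
Proof. by move=> f; apply: HomP => x /=; rewrite addNr. Qed.

HB.instance Definition _ := GRing.isZmodule.Build Hom HomDA HomDC Hom0D HomND.

End HomGroup.

Definition HomC (L : pzRingType) (U V W : lmodType L) (f : Hom U V)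
  (g : Hom V W) : Hom U W := g \o f : {linear U -> W}.

Definition Hom1 (L : pzRingType) (U : lmodType L) : Hom U U :=
  idfun : {linear U -> U}.

(* Left modules; right L-modules are the left modules over [L^c]. *)

Section ModuleCategory.
Variable L : pzRingType.

Definition fingen (U : lmodType L) : Prop :=
  exists s : seq U, forall x : U, exists c : 'I_(size s) -> L,
    x = \sum_(i < size s) c i *: s`_i.

Lemma HomC1f (U V : lmodType L) (f : Hom U V) : HomC (Hom1 U) f = f.
Proof. exact: HomP. Qed.
Lemma HomCf1 (U V : lmodType L) (f : Hom U V) : HomC f (Hom1 V) = f.
Proof. exact: HomP. Qed.
Lemma HomCA (U V W T : lmodType L) (f : Hom U V) (g : Hom V W) (h : Hom W T) :
  HomC f (HomC g h) = HomC (HomC f g) h.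
Proof. exact: HomP. Qed.
Lemma HomCDl (U V W : lmodType L) (f g : Hom U V) (h : Hom V W) :
  HomC (f + g) h = HomC f h + HomC g h.
Proof. by apply: HomP => x; rewrite /= linearD. Qed.
Lemma HomCDr (U V W : lmodType L) (f : Hom U V) (g h : Hom V W) :
  HomC f (g + h) = HomC f g + HomC f h.
Proof. exact: HomP. Qed.

Definition ModCat : preadditive :=
  @Preadditive (lmodType L) (fun U V => Hom U V) (@Hom1 L) (@HomC L)
    HomC1f HomCf1 HomCA HomCDl HomCDr.

Definition modfg : preadditive := @fullsub ModCat fingen.

End ModuleCategory.

Section FreeModule.
Variables (L : pzRingType) (X : choiceType).

Definition fsupp : {pred X -> L^o} :=
  fun g => `[< finite_set [set x | g x != 0] >].

Lemma fsupp_closed : subsemimod_closed fsupp.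
Proof.
apply: GRing.submod_closed_semi; split=> [|a g h /asboolP gF /asboolP hF].
  by apply/asboolP/(sub_finite_set _ (finite_set0 X)) => x /=; rewrite eqxx.
apply/asboolP; apply: (@sub_finite_set _ _
  ([set x | g x != 0] `|` [set x | h x != 0])); last by rewrite finite_setU.
move=> x /= ghx; apply/orP/negPn; rewrite negb_or !negbK.
apply: contra ghx => /andP[/eqP gx /eqP hx].
by apply/eqP; rewrite -[LHS]/(a *: g x + h x) gx hx scaler0 addr0.
Qed.

HB.instance Definition _ := GRing.isSubmodClosed.Build L (X -> L^o) fsupp fsupp_closed.

Record freemod := FreeElt { free_val : X -> L^o; _ : free_val \in fsupp }.

HB.instance Definition _ := [isSub for free_val].
HB.instance Definition _ := [Choice of freemod by <:].
HB.instance Definition _ := [SubChoice_isSubLmodule of freemod by <:].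

Lemma free_fin (g : freemod) : finite_set [set x | free_val g x != 0].
Proof. by case: g => g gF; apply/asboolP. Qed.

Lemma dirac_fin (x : X) : (fun y => (y == x)%:R : L^o) \in fsupp.
Proof.
apply/asboolP/(sub_finite_set _ (finite_set1 x)) => y /=.
by case: (eqVneq y x) => [-> //|_]; rewrite eqxx.
Qed.

Definition free_gen (x : X) : freemod := FreeElt (dirac_fin x).

Section Lift.
Variables (U : lmodType L) (h : X -> U).

(* In effect a sum over the finite support of [g]. *)
Definition free_lift (g : freemod) : U :=
  \sum_(x \in [set: X]) (free_val g x : L) *: h x.

Lemma free_liftE (A : set X) (g : freemod) : finite_set A ->
  [set x | free_val g x != 0] `<=` A ->
  free_lift g = \sum_(x <- fset_set A) (free_val g x : L) *: h x.
Proof.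
move=> Afin sA; rewrite -fsbig_finite //; apply/esym/fsbig_widen => //.
move=> x [_ nAx] /=; case: (eqVneq (free_val g x) 0) => [-> |gx].
  by rewrite scale0r.
by case: nAx; apply: sA.
Qed.

Lemma free_lift_linear : linear free_lift.
Proof.
move=> a g g'.
pose A := [set x | free_val g x != 0] `|` [set x | free_val g' x != 0].
have Afin : finite_set A by rewrite finite_setU; split; exact: free_fin.
rewrite (@free_liftE A g)//; last by move=> x; left.
rewrite (@free_liftE A g')//; last by move=> x; right.
rewrite (@free_liftE A (a *: g + g'))//.
  rewrite scaler_sumr -big_split /=; apply: eq_bigr => x _.
  by rewrite scalerA -scalerDl.
move=> x /= ghx; apply/orP/negPn; rewrite negb_or !negbK.
apply: contra ghx => /andP[/eqP gx /eqP hx].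
by apply/eqP; rewrite -[LHS]/(a *: free_val g x + free_val g' x) gx hx scaler0 addr0.
Qed.

HB.instance Definition _ :=
  GRing.isLinear.Build L freemod U *:%R free_lift free_lift_linear.

Lemma free_lift_gen (x : X) : free_lift (free_gen x) = h x.
Proof.
rewrite (@free_liftE [set x])//; last first.
  by move=> y /=; case: (eqVneq y x) => [-> //|_]; rewrite eqxx.
by rewrite fset_set1 big_seq_fset1 /= eqxx scale1r.
Qed.

End Lift.

Lemma free_ext (U : lmodType L) (f f' : Hom freemod U) :
  (forall x, f (free_gen x) = f' (free_gen x)) -> f = f'.
Proof.
move=> ff'; apply: HomP => g.
have -> : g = \sum_(x <- fset_set [set x | free_val g x != 0])
    (free_val g x : L) *: free_gen x.
  apply: val_inj; rewrite raddf_sum /=; apply: funext => y.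
  rewrite fct_sumE.
  case: (eqVneq (free_val g y) 0) => [gy|gy].
    rewrite gy big1 // => x _; rewrite -[LHS]/(free_val g x * (y == x)%:R).
    by case: (eqVneq y x) => [<-|_]; rewrite ?gy ?mul0r ?mulr0.
  rewrite (big_fsetD1 y) /=; last by rewrite in_fset_set ?inE//; exact: free_fin.
  rewrite big_seq big1 ?addr0 => [|x].
    by rewrite -[RHS]/(free_val g y * (y == y)%:R) eqxx mulr1.
  rewrite !inE => /andP[xy _]; rewrite -[LHS]/(free_val g x * (y == x)%:R).
  by rewrite eq_sym (negPf xy) mulr0.
by rewrite !linear_sum /=; apply: eq_bigr => x _; rewrite !linearZ /= ff'.
Qed.

End FreeModule.

Section Kernel.
Variables (L : pzRingType) (U V : lmodType L) (f : Hom U V).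

Definition kerP : {pred U} := fun x => f x == 0.

Lemma kerP_closed : subsemimod_closed kerP.
Proof.
apply: GRing.submod_closed_semi; split=> [|a x y /eqP fx /eqP fy].
  by apply/eqP; rewrite linear0.
by apply/eqP; rewrite linearP fx fy scaler0 addr0.
Qed.

HB.instance Definition _ := GRing.isSubmodClosed.Build L U kerP kerP_closed.

Record kermod := KerElt { ker_val : U; _ : ker_val \in kerP }.

HB.instance Definition _ := [isSub for ker_val].
HB.instance Definition _ := [Choice of kermod by <:].
HB.instance Definition _ := [SubChoice_isSubLmodule of kermod by <:].

Lemma ker_val_linear : linear ker_val.
Proof. by []. Qed.

HB.instance Definition _ :=
  GRing.isLinear.Build L kermod U *:%R ker_val ker_val_linear.

Definition ker_incl : Hom kermod U := ker_val : {linear kermod -> U}.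

Lemma ker_inclK (x : kermod) : f (ker_incl x) = 0.
Proof. by case: x => x xP; apply/eqP. Qed.

Section Corestrict.
Variables (W : lmodType L) (g : Hom W U).
Hypothesis fg0 : forall w, f (g w) = 0.

Lemma ker_lift_subproof (w : W) : g w \in kerP.
Proof. by apply/eqP. Qed.

Definition ker_lift_fun (w : W) : kermod := KerElt (ker_lift_subproof w).

Lemma ker_lift_linear : linear ker_lift_fun.
Proof. by move=> a u v; apply: val_inj; rewrite /= linearP. Qed.

HB.instance Definition _ :=
  GRing.isLinear.Build L W kermod *:%R ker_lift_fun ker_lift_linear.

Definition ker_lift : Hom W kermod := ker_lift_fun : {linear W -> kermod}.

End Corestrict.
End Kernel.

(* The functorial free resolution
     ... -> Free (Omega (Omega A)) -> Free (Omega A) -> Free A -> A -> 0,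
   where [Free A] is free on the underlying set of [A] and [Omega A] is the
   kernel of the canonical surjection [Free A -> A].  Its terms are not finitely
   generated, but Ext does not depend on the projective resolution, and this one
   makes Ext a bifunctor without any choice. *)

Section FreeResolution.
Variable L : pzRingType.
Implicit Types A B C : lmodType L.

Definition Free A : lmodType L := freemod L A.

Definition aug A : Hom (Free A) A :=
  free_lift (fun x : A => x) : {linear freemod L A -> A}.

Definition Fmap A B (f : Hom A B) : Hom (Free A) (Free B) :=
  free_lift (fun x : A => free_gen L (f x)) : {linear freemod L A -> freemod L B}.

Lemma augE A (x : A) : aug A (free_gen L x) = x.
Proof. exact: free_lift_gen. Qed.

Lemma FmapE A B (f : Hom A B) (x : A) :
  Fmap f (free_gen L x) = free_gen L (f x).
Proof. exact: free_lift_gen. Qed.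

Lemma aug_nat A B (f : Hom A B) : HomC (Fmap f) (aug B) = HomC (aug A) f.
Proof.
apply: free_ext => x.
by rewrite -[LHS]/(aug B (Fmap f _)) FmapE augE -[RHS]/(f (aug A _)) augE.
Qed.

Lemma Fmap1 A : Fmap (Hom1 A) = Hom1 (Free A).
Proof. by apply: free_ext => x; rewrite FmapE. Qed.

Lemma FmapM A B C (f : Hom A B) (g : Hom B C) :
  Fmap (HomC f g) = HomC (Fmap f) (Fmap g).
Proof.
by apply: free_ext => x; rewrite FmapE -[RHS]/(Fmap g (Fmap f _)) !FmapE.
Qed.

Definition Omega A : lmodType L := kermod (aug A).

Definition Oincl A : Hom (Omega A) (Free A) := ker_incl (aug A).

Lemma Omega_map_subproof A B (f : Hom A B) (x : Omega A) :
  aug B (HomC (Oincl A) (Fmap f) x) = 0.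
Proof.
rewrite -[LHS]/(HomC (Fmap f) (aug B) (Oincl A x)) aug_nat.
by rewrite -[LHS]/(f (aug A (Oincl A x))) /Oincl ker_inclK linear0.
Qed.

Definition Omega_map A B (f : Hom A B) : Hom (Omega A) (Omega B) :=
  ker_lift (@Omega_map_subproof A B f).

Lemma Oincl_inj A B (f g : Hom A (Omega B)) :
  HomC f (Oincl B) = HomC g (Oincl B) -> f = g.
Proof.
by move=> fg; apply: HomP => x; apply: val_inj; have /(congr1 (fun h : Hom _ _ => h x)) := fg.
Qed.

Lemma Oincl_nat A B (f : Hom A B) :
  HomC (Omega_map f) (Oincl B) = HomC (Oincl A) (Fmap f).
Proof. exact: HomP. Qed.

Lemma Omega_map1 A : Omega_map (Hom1 A) = Hom1 (Omega A).
Proof. by apply: Oincl_inj; rewrite Oincl_nat Fmap1; apply: HomP. Qed.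

Lemma Omega_mapM A B C (f : Hom A B) (g : Hom B C) :
  Omega_map (HomC f g) = HomC (Omega_map f) (Omega_map g).
Proof.
apply: Oincl_inj; rewrite Oincl_nat FmapM HomCA -Oincl_nat -!HomCA.
by rewrite Oincl_nat.
Qed.

Fixpoint syz (k : nat) A : lmodType L :=
  if k is k'.+1 then Omega (syz k' A) else A.

Fixpoint syz_map (k : nat) A B (f : Hom A B) : Hom (syz k A) (syz k B) :=
  if k is k'.+1 then Omega_map (syz_map k' f) else f.

Definition fres (k : nat) A : lmodType L := Free (syz k A).

Definition res_map (k : nat) A B (f : Hom A B) : Hom (fres k A) (fres k B) :=
  Fmap (syz_map k f).

Definition res_d (k : nat) A : Hom (fres k.+1 A) (fres k A) :=
  HomC (aug (syz k.+1 A)) (Oincl (syz k A)).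

Lemma syz_map1 k A : syz_map k (Hom1 A) = Hom1 (syz k A).
Proof. by elim: k => //= k ->; rewrite Omega_map1. Qed.

Lemma syz_mapM k A B C (f : Hom A B) (g : Hom B C) :
  syz_map k (HomC f g) = HomC (syz_map k f) (syz_map k g).
Proof. by elim: k => //= k ->; rewrite Omega_mapM. Qed.

Lemma res_map1 k A : res_map k (Hom1 A) = Hom1 (fres k A).
Proof. by rewrite /res_map syz_map1 Fmap1. Qed.

Lemma res_mapM k A B C (f : Hom A B) (g : Hom B C) :
  res_map k (HomC f g) = HomC (res_map k f) (res_map k g).
Proof. by rewrite /res_map syz_mapM FmapM. Qed.

Lemma res_d_nat k A B (f : Hom A B) :
  HomC (res_map k.+1 f) (res_d k B) = HomC (res_d k A) (res_map k f).
Proof.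
rewrite /res_d HomCA aug_nat -HomCA /= Oincl_nat.
by rewrite HomCA.
Qed.

Lemma aug_surj A (x : A) : exists u : Free A, aug A u = x.
Proof. by exists (free_gen L x); rewrite augE. Qed.

Lemma aug_Oincl A : HomC (Oincl A) (aug A) = 0.
Proof. by apply: HomP => x; rewrite -[LHS]/(aug A (Oincl A x)) ker_inclK. Qed.

End FreeResolution.

Section Coboundaries.
Variable L : pzRingType.
Implicit Types A B : lmodType L.

Definition is_coboundary k A B : Hom (fres k A) B -> Prop :=
  match k with
  | 0 => fun u => u = 0
  | m.+1 => fun u => exists v : Hom (fres m A) B, u = HomC (res_d m A) v
  end.

Lemma HomC0 A B C (f : Hom A B) : HomC f (0 : Hom B C) = 0.
Proof. exact: HomP. Qed.

Lemma HomCN A B C (f : Hom A B) (g : Hom B C) : HomC f (- g) = - HomC f g.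
Proof. exact: HomP. Qed.

Lemma Hom0C A B C (g : Hom B C) : HomC (0 : Hom A B) g = 0.
Proof. by apply: HomP => x; rewrite /= linear0. Qed.

Lemma HomNC A B C (f : Hom A B) (g : Hom B C) : HomC (- f) g = - HomC f g.
Proof. by apply: HomP => x; rewrite /= linearN. Qed.

Lemma is_coboundary0 k A B : @is_coboundary k A B 0.
Proof. by case: k => //= m; exists 0; rewrite HomC0. Qed.

Lemma is_coboundaryB k A B (u v : Hom (fres k A) B) :
  is_coboundary u -> is_coboundary v -> is_coboundary (u - v).
Proof.
case: k u v => [|m] u v /=; first by move=> -> ->; rewrite subr0.
by move=> [u' ->] [v' ->]; exists (u' - v'); rewrite HomCDr HomCN.
Qed.

Lemma is_coboundary_map k A A' B B' (f : Hom A' A) (g : Hom B B')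
    (u : Hom (fres k A) B) :
  is_coboundary u -> is_coboundary (HomC (HomC (res_map k f) u) g).
Proof.
case: k u => [|m] u /=; first by move=> ->; rewrite HomC0 Hom0C.
move=> [v ->]; exists (HomC (HomC (res_map m f) v) g).
by rewrite (HomCA (res_map m.+1 f)) res_d_nat !HomCA.
Qed.

(* The resolution is additive only up to homotopy: [syz_map] of a sum differs
   from the sum of the [syz_map]s by a map that factors through a free module. *)
Definition syz_homotopic k A B : Hom (syz k A) (syz k B) -> Prop :=
  match k with
  | 0 => fun s => s = 0
  | m.+1 => fun s => exists h : Hom (fres m A) (syz m.+1 B), s = HomC (Oincl _) h
  end.

Lemma Free_lift A B (h : Hom (Free A) B) :
  exists h' : Hom (Free A) (Free B), HomC h' (aug B) = h.
Proof.
exists (free_lift (fun x : A => free_gen L (h (free_gen L x)))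
  : {linear freemod L A -> freemod L B}).
apply: free_ext => x.
by rewrite -[LHS]/(aug B (free_lift _ _)) free_lift_gen augE.
Qed.

Lemma syz_homotopic_lift k A B (s : Hom (syz k A) (syz k B)) :
  syz_homotopic s -> exists h : Hom (syz k A) (fres k B),
    s = HomC h (aug (syz k B)) /\
    (forall (C : lmodType L) (u : Hom (fres k B) C),
       is_coboundary (HomC (HomC (aug (syz k A)) h) u)).
Proof.
case: k s => [|m] s /=.
  move=> ->; exists 0; rewrite Hom0C; split=> // C u.
  by rewrite HomC0 Hom0C.
move=> [h ->]; have [h' <-] := Free_lift h.
exists (HomC (Oincl _) h'); rewrite HomCA; split=> // C u.
by exists (HomC h' u); rewrite /res_d !HomCA.
Qed.

Lemma syz_mapD k A B (f g : Hom A B) :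
  syz_homotopic (syz_map k (f + g) - (syz_map k f + syz_map k g)).
Proof.
elim: k => [|k /syz_homotopic_lift[h [eh _]]] /=; first by rewrite subrr.
set a := syz_map k (f + g) in eh *; set b := syz_map k f in eh *.
set c := syz_map k g in eh *.
pose t : Hom (fres k A) (fres k B) :=
  Fmap a - (Fmap b + Fmap c) - HomC (aug _) h.
have t0 : HomC t (aug _) = 0.
  rewrite /t !HomCDl !HomNC HomCDl !aug_nat -HomCA -eh.
  by rewrite !HomCDr !HomCN HomCDr subrr.
have t0' x : aug (syz k B) (t x) = 0.
  by have /(congr1 (fun u : Hom _ _ => u x)) := t0.
exists (ker_lift t0'); apply: Oincl_inj.
rewrite !HomCDl !HomNC !HomCDl !Oincl_nat.
have -> : HomC (HomC (Oincl (syz k A)) (ker_lift t0')) (Oincl (syz k B)) =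
  HomC (Oincl (syz k A)) t by exact: HomP.
rewrite /t !HomCDr !HomCN HomCDr (HomCA _ (aug _) h).
by rewrite aug_Oincl Hom0C subr0.
Qed.

Lemma res_mapD k A B C (f g : Hom A B) (u : Hom (fres k B) C) :
  HomC (res_d k B) u = 0 ->
  is_coboundary (HomC (res_map k (f + g)) u -
                 (HomC (res_map k f) u + HomC (res_map k g) u)).
Proof.
move=> du; have [h [eh cb]] := syz_homotopic_lift (syz_mapD k f g).
have incl0 : HomC (Oincl _) u = 0.
  apply: HomP => x; have [y <-] := aug_surj x.
  by have /(congr1 (fun v : Hom _ _ => v y)) := du.
pose t : Hom (fres k A) (fres k B) :=
  res_map k (f + g) - (res_map k f + res_map k g) - HomC (aug _) h.
have t0 : HomC t (aug _) = 0.
  rewrite /t !HomCDl !HomNC HomCDl !aug_nat -HomCA -eh.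
  by rewrite !HomCDr !HomCN HomCDr subrr.
have t0' x : aug (syz k B) (t x) = 0.
  by have /(congr1 (fun u : Hom _ _ => u x)) := t0.
have : HomC t u = 0.
  have -> : t = HomC (ker_lift t0') (Oincl _) by exact: HomP.
  by rewrite -HomCA incl0 HomC0.
rewrite /t !HomCDl !HomNC HomCDl => /eqP; rewrite subr_eq0 => /eqP ->.
exact: cb.
Qed.

End Coboundaries.

(* Ext^n(A, B) is the n-th cohomology of the complex Hom(fres A, B). *)

Section Ext.
Variables (L : pzRingType) (n : nat).
Implicit Types A B : lmodType L.

Definition cocycle A B : {pred Hom (fres n A) B} :=
  fun u => HomC (res_d n A) u == 0.

Lemma cocycle_closed A B : zmod_closed (@cocycle A B).
Proof.
split=> [|u v /eqP u0 /eqP v0]; first by apply/eqP; rewrite HomC0.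
by apply/eqP; rewrite HomCDr HomCN u0 v0 subr0.
Qed.

HB.instance Definition _ A B :=
  GRing.isZmodClosed.Build _ (@cocycle A B) (@cocycle_closed A B).

Record cocycles A B := Cocycle { cocycle_val : Hom (fres n A) B; _ : cocycle_val \in @cocycle A B }.

HB.instance Definition _ A B := [isSub for @cocycle_val A B].
HB.instance Definition _ A B := [Choice of cocycles A B by <:].
HB.instance Definition _ A B := [SubChoice_isSubZmodule of cocycles A B by <:].

Definition coboundary A B : {pred cocycles A B} :=
  fun u => `[< is_coboundary (cocycle_val u) >].

Lemma coboundary_closed A B : zmod_closed (@coboundary A B).
Proof.
rewrite /coboundary; split=> [|u v /asboolP u0 /asboolP v0]; apply/asboolP.
  by rewrite [cocycle_val 0](raddf0 val : _ = 0); exact: is_coboundary0.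
have -> : cocycle_val (u - v) = cocycle_val u - cocycle_val v by exact: (raddfB val).
exact: is_coboundaryB.
Qed.

HB.instance Definition _ A B :=
  GRing.isZmodClosed.Build _ (@coboundary A B) (@coboundary_closed A B).

Definition Ext A B : zmodType := Quotient.quot (@coboundary A B).

Definition Ext_class A B (u : cocycles A B) : Ext A B := (\pi_(Quotient.quot (@coboundary A B)) u)%qT.

Lemma Ext_classD A B (u v : cocycles A B) :
  Ext_class (u + v) = Ext_class u + Ext_class v.
Proof. exact: raddfD. Qed.

Lemma Ext_classP A B (u v : cocycles A B) :
  Ext_class u = Ext_class v <-> is_coboundary (cocycle_val u - cocycle_val v).
Proof.
rewrite (_ : cocycle_val u - cocycle_val v = cocycle_val (u - v)); last first.
  by rewrite [RHS](raddfB val).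
split=> [/eqP|cb]; last apply/eqP.
  by rewrite /Ext_class -Quotient.idealrBE => /asboolP.
by rewrite /Ext_class -Quotient.idealrBE; apply/asboolP.
Qed.

Lemma Ext_ind A B (P : Ext A B -> Prop) :
  (forall u : cocycles A B, P (Ext_class u)) -> forall x, P x.
Proof. by move=> PZ; elim/quotW => u; apply: PZ. Qed.

Section Functoriality.
Variables (A A' B B' : lmodType L) (f : Hom A' A) (g : Hom B B').

Lemma Z_map_subproof (u : cocycles A B) :
  HomC (HomC (res_map n f) (cocycle_val u)) g \in @cocycle A' B'.
Proof.
case: u => u /eqP u0 /=; apply/eqP.
by rewrite !HomCA -res_d_nat -(HomCA _ (res_d n A)) u0 HomC0 Hom0C.
Qed.

Definition Z_map (u : cocycles A B) : cocycles A' B' := Cocycle (Z_map_subproof u).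

Definition Ext_map_fun (x : Ext A B) : Ext A' B' := Ext_class (Z_map (repr x)).

Lemma Ext_map_funE (u : cocycles A B) : Ext_map_fun (Ext_class u) = Ext_class (Z_map u).
Proof.
apply/Ext_classP => /=.
have /Ext_classP/(is_coboundary_map f g) :
  Ext_class (repr (Ext_class u)) = Ext_class u by rewrite /Ext_class reprK.
by rewrite HomCDr HomCN HomCDl HomNC.
Qed.

Lemma Ext_map_additive : zmod_morphism Ext_map_fun.
Proof.
elim/Ext_ind => u; elim/Ext_ind => v.
rewrite -[Ext_class u - _](raddfB \pi%qT) !Ext_map_funE.
rewrite -[RHS](raddfB \pi%qT); congr Ext_class; apply: val_inj.
by rewrite [RHS](raddfB val) /= HomCDr HomCN HomCDl HomNC.
Qed.

HB.instance Definition _ :=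
  GRing.isZmodMorphism.Build (Ext A B) (Ext A' B') Ext_map_fun Ext_map_additive.

Definition Ext_map : {additive Ext A B -> Ext A' B'} := Ext_map_fun.

End Functoriality.

Lemma Ext_map1 A B (x : Ext A B) : Ext_map (Hom1 A) (Hom1 B) x = x.
Proof.
elim/Ext_ind: x => u; rewrite /= Ext_map_funE; congr Ext_class.
by apply: val_inj; rewrite /= res_map1 HomC1f HomCf1.
Qed.

Lemma Ext_mapM A A' A'' B B' B'' (f : Hom A' A) (f' : Hom A'' A')
    (g : Hom B B') (g' : Hom B' B'') (x : Ext A B) :
  Ext_map (HomC f' f) (HomC g g') x = Ext_map f' g' (Ext_map f g x).
Proof.
elim/Ext_ind: x => u; rewrite /= !Ext_map_funE; congr Ext_class.
by apply: val_inj; rewrite /= res_mapM !HomCA.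
Qed.

Lemma Ext_mapDr A A' B B' (f : Hom A' A) (g g' : Hom B B') (x : Ext A B) :
  Ext_map f (g + g') x = Ext_map f g x + Ext_map f g' x.
Proof.
elim/Ext_ind: x => u; rewrite /= !Ext_map_funE -[RHS]Ext_classD.
by congr Ext_class; apply: val_inj; rewrite [RHS](raddfD val) /= HomCDr.
Qed.

Lemma Ext_mapDl A A' B B' (f f' : Hom A' A) (g : Hom B B') (x : Ext A B) :
  Ext_map (f + f') g x = Ext_map f g x + Ext_map f' g x.
Proof.
elim/Ext_ind: x => -[u u0]; rewrite /= !Ext_map_funE -[RHS]Ext_classD.
apply/Ext_classP; rewrite [cocycle_val (_ + _)](raddfD val) /= -!HomCA.
by apply: res_mapD; rewrite HomCA (eqP u0) Hom0C.
Qed.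

End Ext.

Section ExtFunctors.
Variables (L : pzRingType) (n : nat).

Definition Ext_cov (A : modfg L) : functor (modfg L) :=
  @Functor (modfg L) (fun X => Ext n (sval A) (sval X))
    (fun X Y f => Ext_map n (Hom1 (sval A)) f)
    (fun X => @Ext_map1 L n (sval A) (sval X))
    (fun X Y Z f g x => etrans
       (congr1 (fun h => Ext_map n h (HomC f g) x) (esym (HomC1f (Hom1 (sval A)))))
       (Ext_mapM (Hom1 _) (Hom1 _) f g x))
    (fun X Y f g x => Ext_mapDr (Hom1 _) f g x).

Definition Ext_contra (A : modfg L) : functor (opcat (modfg L)) :=
  @Functor (opcat (modfg L)) (fun X => Ext n (sval X) (sval A))
    (fun X Y f => Ext_map n f (Hom1 (sval A)))
    (fun X => @Ext_map1 L n (sval X) (sval A))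
    (fun X Y Z f g x => etrans
       (congr1 (fun h => Ext_map n (HomC g f) h x) (esym (HomC1f (Hom1 (sval A)))))
       (Ext_mapM f g (Hom1 _) (Hom1 _) x))
    (fun X Y f g x => Ext_mapDl f g (Hom1 _) x).

End ExtFunctors.

Definition is_ideal (R : comPzRingType) (I : set R) : Prop :=
  [/\ I 0, forall x y, I x -> I y -> I (x + y) & forall a x, I x -> I (a * x)].

Definition artinian (R : comPzRingType) : Prop :=
  forall I : nat -> set R, (forall k, is_ideal (I k)) ->
    (forall k, I k.+1 `<=` I k) ->
    exists N : nat, forall k, (N <= k)%N -> I k = I N.

Definition artin_algebra (L : pzRingType) : Prop :=
  exists (R : comPzRingType) (phi : {rmorphism R -> L}),
    [/\ artinian R, forall r x, phi r * x = x * phi r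
      & exists s : seq L, forall x : L, exists c : 'I_(size s) -> R,
          x = \sum_(i < size s) phi (c i) * s`_i].

Section ClusterTilting.
Variable L : pzRingType.
Implicit Types M : modfg L -> Prop.

Definition right_approx M (X N : modfg L) (f : hom N X) : Prop :=
  M N /\ forall (N' : modfg L) (g : hom N' X), M N' ->
    exists h : hom N' N, g = hcomp h f.

Definition left_approx M (X N : modfg L) (f : hom X N) : Prop :=
  M N /\ forall (N' : modfg L) (g : hom X N'), M N' ->
    exists h : hom N N', g = hcomp f h.

Definition functorially_finite M : Prop :=
  forall X : modfg L, (exists (N : modfg L) (f : hom N X), right_approx M f) /\
                     (exists (N : modfg L) (f : hom X N), left_approx M f).

Definition generating M : Prop :=
  forall X : modfg L, exists (N : modfg L) (f : Hom (sval N) (sval X)),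
    M N /\ forall x, exists y, f y = x.

Definition cogenerating M : Prop :=
  forall X : modfg L, exists (N : modfg L) (f : Hom (sval X) (sval N)),
    M N /\ injective f.

Definition Ext_vanishes (i : nat) (X Y : modfg L) : Prop :=
  forall x : Ext i (sval X) (sval Y), x = 0.

Definition cluster_tilting (n : nat) M : Prop :=
  [/\ additive_category (fullsub M),
      functorially_finite M,
      generating M /\ cogenerating M,
      (forall X, M X <-> forall N i, M N -> (0 < i < n)%N -> Ext_vanishes i N X)
    & (forall X, M X <-> forall N i, M N -> (0 < i < n)%N -> Ext_vanishes i X N)].

End ClusterTilting.

(* Main.v *)
(* An idempotent natural endomorphism of Ext^n(A,-) on M is induced by an
   endomorphism f of A, as in the theorem of Hilton and Rees. Resolve A by a
   sequence 0 -> Z_n -> N_{n-1} -> ... -> N_0 -> A -> 0 with N_0 projective, the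
   other N_i -> Z_i right M-approximations, hence Z_n in M. Its class xi in
   Ext^n(A,Z_n) generates Ext^n(A,-) on M, and a class in Ext^n(A,Z_n) is a
   pullback f^* xi exactly when it dies in Ext^n(A,N_{n-1}); since xi dies there,
   so does its image under any natural endomorphism. Then f^2 - f acts by zero on
   Ext^n(A,-), and Fitting's lemma replaces f by an idempotent e with the same
   action, so that B is the image of e. Part (ii) is dual: N_0 is replaced by an
   injective module, which is finitely generated because Lambda is an artin
   algebra: over a commutative artinian ring a maximal essential extension of a
   finitely generated module is finitely generated, and coinduction to Lambda
   preserves this.

   Chasing along the resolution, the classes are shifted in their second argument
   only: the functorial syzygies make the connecting map for 0 -> Z -> N -> Y -> 0
   the composite of Omega^(k+1) V -> Omega Y with a fixed map Omega Y -> Z, and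
   shifting the coefficients X along an embedding into an injective module
   replaces the long exact sequence in the first argument. *)
From HB Require Import structures.
From mathcomp Require Import all_boot all_order all_algebra.
From mathcomp Require Import boolp classical_sets.
From mathcomp Require Import zify.
Require Import Defs.

Set Implicit Arguments.
Unset Strict Implicit.
Unset Printing Implicit Defensive.
Import GRing.Theory Num.Theory.
Local Open Scope classical_set_scope.
Local Open Scope ring_scope.

(** * Linear maps, submodules and quotients *)

Lemma dependent_choice (T : Type) (R : T -> T -> Prop) (x0 : T) :
  (forall x, exists y, R x y) ->
  exists f : nat -> T, f 0%N = x0 /\ forall k, R (f k) (f k.+1).
Proof.
move=> Rtot; have [F FP] := boolp.choice Rtot.
by exists (fun k => iter k F x0); split=> // k; apply: FP.
Qed.

Lemma Zorn_above (T : Type) (P : set T -> Prop) (X0 : set T) :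
  P X0 ->
  (forall F : set (set T), F !=set0 -> F `<=` [set X | P X /\ X0 `<=` X] ->
     total_on F subset -> P (\bigcup_(X in F) X)) ->
  exists A, [/\ P A, X0 `<=` A & forall B, P B -> A `<=` B -> B = A].
Proof.
(* The empty set is adjoined because [Zorn_bigcup] also takes the union of the empty chain, while
   [Pch] speaks of nonempty chains only. *)
move=> P0 Pch; pose P' := [set X | X = set0 \/ P X /\ X0 `<=` X].
have [F sF totF|A [PA Amax]] := @Zorn_bigcup T P'.
  pose F' := F `\ set0.
  have eF : \bigcup_(X in F) X = \bigcup_(X in F') X.
    apply/seteqP; split=> x [X FX Xx]; last by exists X => //; case: FX.
    by exists X => //; split=> // X_0; move: Xx; rewrite X_0.
  have [[X F'X]|F'0] := pselect (exists X, F' X); last first.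
    left; rewrite eF; apply/seteqP; split=> // x [Y F'Y _].
    by case: F'0; exists Y.
  right; rewrite eF; split.
    apply: Pch; first by exists X.
    - by move=> Y [/sF[-> /(_ erefl)|]].
    - by move=> Y Z [FY _] [FZ _]; apply: totF.
  move=> x X0x; exists X => //.
  by case: F'X => /sF[-> /(_ erefl)|[_ /(_ _ X0x)]].
have A0 : P A /\ X0 `<=` A.
  case: PA => // A0; have [X00|nX0] := pselect (X0 `<=` set0).
    have -> : A = X0 by rewrite A0; apply/esym/seteqP; split.
    by split.
  exfalso; apply: (Amax X0); last by right; split.
  by rewrite A0; split=> [x []|/nX0].
have [PA' sA] := A0; exists A; split=> // B PB AB; apply: contrapT => nBA.
apply: (Amax B); last by right; split=> // x /sA /AB.
by split=> // BA; apply: nBA; apply/seteqP.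
Qed.

Section Linear.
Variable L : pzRingType.
Implicit Types U V W Y Z N : lmodType L.

Definition is_submod U (S : set U) : Prop :=
  S 0 /\ forall a x y, S x -> S y -> S (a *: x + y).

Lemma submod0 U (S : set U) : is_submod S -> S 0. Proof. by case. Qed.
Lemma submodP U (S : set U) a x y : is_submod S -> S x -> S y -> S (a *: x + y).
Proof. by case=> _; apply. Qed.
Lemma submodD U (S : set U) x y : is_submod S -> S x -> S y -> S (x + y).
Proof. by move=> /submodP SP Sx Sy; rewrite -(scale1r x); apply: SP. Qed.
Lemma submodZ U (S : set U) a x : is_submod S -> S x -> S (a *: x).
Proof. by move=> SP Sx; rewrite -[_ *: _]addr0; apply: submodP => //; apply: submod0. Qed.
Lemma submodN U (S : set U) x : is_submod S -> S x -> S (- x).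
Proof. by move=> SP Sx; rewrite -scaleN1r; apply: submodZ. Qed.
Lemma submodB U (S : set U) x y : is_submod S -> S x -> S y -> S (x - y).
Proof. by move=> SP Sx Sy; apply: submodD => //; apply: submodN. Qed.

Lemma Hom_of_linear U V (f : U -> V) : linear f -> exists g : Hom U V, forall x, g x = f x.
Proof.
move=> fL; pose m := GRing.isLinear.Build L U V *:%R f fL.
pose g : {linear U -> V} := HB.pack f m.
by exists g.
Qed.

(** Linearity of the relation reduces single-valuedness to the fibre over 0. Maps found by diagram
    chasing are built this way. *)
Lemma Hom_of_relation U V (R : U -> V -> Prop) :
  (forall x, exists y, R x y) -> (forall y, R 0 y -> y = 0) ->
  (forall a x x' y y', R x y -> R x' y' -> R (a *: x + x') (a *: y + y')) ->
  exists g : Hom U V, forall x, R x (g x).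
Proof.
move=> Rtot R0 RL; have [f fR] := boolp.choice Rtot.
have Rf x y : R x y -> y = f x.
  move=> Rxy; apply/eqP; rewrite -subr_eq0; apply/eqP; apply: R0.
  rewrite -(subrr x) -(scaleN1r x) -scaleN1r addrC [X in R _ X]addrC.
  exact: RL.
have fL : linear f by move=> a x y; apply/esym/Rf/RL.
have [g gf] := Hom_of_linear fL.
by exists g => x; rewrite gf.
Qed.

Definition short_exact Z N Y (j : Hom Z N) (p : Hom N Y) : Prop :=
  [/\ injective j, (forall y, exists x, p x = y)
    & forall x, p x = 0 <-> exists z, j z = x].

Lemma exact3_comp0 Z N Y (j : Hom Z N) (p : Hom N Y) : short_exact j p -> HomC j p = 0.
Proof. by case=> _ _ E; apply: HomP => z /=; apply/E; exists z. Qed.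

Lemma ker_factor Z N Y W (j : Hom Z N) (p : Hom N Y) (g : Hom W N) :
  short_exact j p -> HomC g p = 0 -> exists h : Hom W Z, HomC h j = g.
Proof.
case=> ji _ E gp0; have [|y|a x x' y y'|h hP] := @Hom_of_relation W Z (fun w z => j z = g w).
- by move=> w; apply/E; have /(congr1 (fun u : Hom _ _ => u w)) := gp0.
- by rewrite linear0 => jy; apply: ji; rewrite jy linear0.
- by rewrite !linearP => -> ->.
- by exists h; apply: HomP => w; apply: hP.
Qed.

Lemma coker_factor N Y W (p : Hom N Y) (g : Hom N W) :
  (forall y, exists x, p x = y) -> (forall x, p x = 0 -> g x = 0) ->
  exists h : Hom Y W, HomC p h = g.
Proof.
move=> ps pg.
have [y||a y y' w w' [x [<- <-]] [x' [<- <-]]|h hP] :=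
    @Hom_of_relation Y W (fun y w => exists x, p x = y /\ g x = w).
- by have [x <-] := ps y; exists (g x), x.
- by move=> w [x [/pg -> ->]].
- by exists (a *: x + x'); rewrite !linearP.
- exists h; apply: HomP => x; have [x' [e gx']] := hP (p x).
  rewrite -[LHS]/(h (p x)) -gx'; apply/eqP; rewrite -subr_eq0 -linearB; apply/eqP/pg.
  by rewrite linearB e subrr.
Qed.

Lemma exact3_ker N Y (p : Hom N Y) :
  (forall y, exists x, p x = y) -> short_exact (ker_incl p) p.
Proof.
move=> ps; split=> //; first by move=> x y /val_inj.
move=> x; split=> [/eqP px|[z <-]]; last exact: ker_inclK.
by exists (KerElt (px : x \in kerP p)).
Qed.

Section Quotient.
Variables (U : lmodType L) (S : set U) (SP : is_submod S).

(** The proof [SP] is an index of the predicate, so that the closure instance and the quotient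
    module can be inferred from the type. *)
Definition quo_pred of is_submod S : {pred U} := fun x => `[< S x >].
Local Notation Sp := (quo_pred SP).

Lemma quo_closed : zmod_closed Sp.
Proof.
split=> [|x y /asboolP Sx /asboolP Sy]; apply/asboolP; first exact: submod0.
exact: submodB.
Qed.

HB.instance Definition _ := GRing.isZmodClosed.Build U Sp quo_closed.

Definition quomod : Type := Quotient.quot Sp.
HB.instance Definition _ := GRing.Zmodule.on quomod.

Definition quo_proj (x : U) : quomod := (\pi_(Quotient.quot Sp) x)%qT.

Lemma quo_projD x y : quo_proj (x + y) = quo_proj x + quo_proj y.
Proof. exact: raddfD. Qed.

Lemma quo_projE x y : quo_proj x = quo_proj y <-> S (x - y).
Proof.
split=> [/eqP|Sxy]; last apply/eqP; rewrite /quo_proj -Quotient.idealrBE.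
  by move/asboolP.
exact/asboolP.
Qed.

Definition quo_scale (a : L) (x : quomod) : quomod := quo_proj (a *: repr (x : Quotient.quot Sp)).

Lemma quo_scaleE a x : quo_scale a (quo_proj x) = quo_proj (a *: x).
Proof.
apply/quo_projE; rewrite -scalerBr; apply: submodZ => //; apply/quo_projE.
by rewrite /quo_proj reprK.
Qed.

Lemma quo_ind (P : quomod -> Prop) : (forall x, P (quo_proj x)) -> forall x, P x.
Proof. by move=> Px; elim/quotW => x; apply: Px. Qed.

Lemma quo_scaleA a b v : quo_scale a (quo_scale b v) = quo_scale (a * b) v.
Proof. by elim/quo_ind: v => v; rewrite !quo_scaleE scalerA. Qed.
Lemma quo_scale1 : left_id 1 quo_scale.
Proof. by elim/quo_ind => v; rewrite quo_scaleE scale1r. Qed.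
Lemma quo_scaleDr : right_distributive quo_scale +%R.
Proof.
move=> a; elim/quo_ind=> u; elim/quo_ind => v.
by rewrite -quo_projD !quo_scaleE scalerDr quo_projD.
Qed.
Lemma quo_scaleDl v : {morph quo_scale^~ v : a b / a + b}.
Proof.
by move=> a b; elim/quo_ind: v => v; rewrite !quo_scaleE scalerDl quo_projD.
Qed.

HB.instance Definition _ := GRing.Zmodule_isLmodule.Build L quomod
  quo_scaleA quo_scale1 quo_scaleDr quo_scaleDl.

End Quotient.

Lemma quotient_exists U (S : set U) : is_submod S ->
  exists (C : lmodType L) (p : Hom U C),
    (forall y, exists x, p x = y) /\ (forall x, p x = 0 <-> S x).
Proof.
move=> SP; have [a x y|p pE] := @Hom_of_linear U (quomod SP) (quo_proj SP).
  by rewrite quo_projD -quo_scaleE.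
exists (quomod SP), p; split=> [|x].
  by elim/quo_ind => x; exists x; rewrite pE.
have /= := quo_projE SP x 0; rewrite pE subr0.
suff -> : quo_proj SP 0 = 0 by [].
exact: raddf0.
Qed.

Lemma exact3_coker Z N (j : Hom Z N) : injective j ->
  exists (Y : lmodType L) (p : Hom N Y), short_exact j p.
Proof.
move=> ji; have [|C [p [ps pE]]] := @quotient_exists N [set x | exists z, j z = x].
  split; first by exists 0; rewrite linear0.
  by move=> a x y [u <-] [v <-]; exists (a *: u + v); rewrite linearP.
by exists C, p.
Qed.

Definition injective_module (E : lmodType L) : Prop :=
  forall V W (j : Hom V W) (g : Hom V E), injective j ->
    exists h : Hom W E, HomC j h = g.

End Linear.

(** * Enough injective modules *)

(** Partial extensions of [g] along [j] are ordered by inclusion of their graphs in [W * D]. A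
    maximal graph has domain [W], since divisibility supplies a value at any further [w]. *)
Lemma divisible_injective (D : lmodType int) :
  (forall (d : D) (n : nat), (0 < n)%N -> exists d', n%:Z *: d' = d) ->
  injective_module D.
Proof.
move=> div V W j g ji.
pose good (G : set (W * D)%type) := @is_submod int (W * D)%type G /\
   forall d, G (0, d) -> d = 0.
pose G0 : set (W * D)%type := [set u | exists v, u = (j v, g v)].
have [||A [[AS A0] G0A Amax]] := @Zorn_above _ good G0.
- split; last first.
    by move=> d [v [/esym jv ->]]; rewrite (ji v 0) ?linear0.
  split; first by exists 0; rewrite !linear0.
  by move=> a x y [u ->] [v ->]; exists (a *: u + v); rewrite !linearP.
- move=> F [X0 FX0] sF totF; split; last first.
    by move=> d [X FX Xd]; have [[_ +] _] := sF X FX; apply.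
  split; first by exists X0 => //; have [[/submod0]] := sF X0 FX0.
  move=> a x y [X FX Xx] [Y FY Yy].
  have [XY|YX] := totF X Y FX FY.
    by exists Y => //; have [[SY _] _] := sF Y FY; apply: submodP => //; apply: XY.
  by exists X => //; have [[SX _] _] := sF X FX; apply: submodP => //; apply: YX.
have Afun w d d' : A (w, d) -> A (w, d') -> d = d'.
  move=> Ad Ad'; apply/eqP; rewrite -subr_eq0; apply/eqP; apply: A0.
  by have := submodB AS Ad Ad'; rewrite /GRing.add /GRing.opp /= /add_pair /= subrr.
have Atot w : exists d, A (w, d).
  (* [d1] is the value to give to [w]. If [n] is the least positive integer with [n w] in the
     domain, the value at [n w] is divided by [n]; if there is none, 0 will do. *)
  have [d1 d1P] : exists d1, forall (m : int) d, A (m *: w, d) -> d = m *: d1.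
    have [exn|nex] := pselect (exists n, `[< (0 < n)%N /\ exists d, A (n%:Z *: w, d) >]).
      have [n /asboolP[n0 [d0 Ad0]] nmin] := ex_minnP exn.
      have [d1 d1E] := div d0 n n0; exists d1 => m d.
      rewrite (divz_eq m n%:Z); set q := (m %/ n)%Z; set r := (m %% n)%Z => Ad.
      have r0 : (0 <= r)%R by apply: modz_ge0; lia.
      have rn : (r < n%:Z)%R by apply: ltz_pmod; lia.
      have Ar : A (r *: w, d - q *: d0).
        have := submodP (- q) AS Ad0 Ad.
        rewrite -[_ + _]/(_ *: (n%:Z *: w) + _, - q *: d0 + d).
        by rewrite scalerA mulNr scaleNr scalerDl addKr scaleNr addrC.
      have [r_0|rN0] := eqVneq r 0; last first.
        have : (n <= `|r|)%N.
          apply: nmin; apply/asboolP; split; first by rewrite lt0n absz_eq0.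
          by exists (d - q *: d0); rewrite gez0_abs.
        by lia.
      move: Ar; rewrite r_0 scale0r addr0 => /A0 /eqP; rewrite subr_eq0 => /eqP ->.
      by rewrite -d1E scalerA.
    exists 0 => m d Ad; rewrite scaler0.
    have [m0|mN0] := eqVneq m 0; first by move: Ad; rewrite m0 scale0r => /A0.
    case: nex; exists `|m|%N; apply/asboolP; rewrite lt0n absz_eq0 mN0; split=> //.
    rewrite abszE; have [m0|m0] := ger0P m; first by exists d.
    by exists (- d); have := submodN AS Ad; rewrite -[- (_, _)]/(- (m *: w), - d) scaleNr.
  pose B : set (W * D)%type :=
    [set u | exists x d (m : int), A (x, d) /\ u = (x + m *: w, d + m *: d1)].
  have AB : A `<=` B.
    by case=> x d Axd; exists x, d, 0; rewrite !scale0r !addr0.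
  have <- : B = A.
    apply: Amax (AB); split; last first.
      move=> d [x [d' [m [Axd [xm ->]]]]].
      have := d1P (- m) d'; rewrite scaleNr.
      have -> : - (m *: w) = x.
        by apply/esym/eqP; rewrite -addr_eq0 -xm.
      by move=> -> //; rewrite scaleNr addNr.
    split; first by apply: AB; apply: submod0.
    move=> a _ _ [x [d [m [Ax ->]]]] [y [e [k [Ay ->]]]].
    exists (a *: x + y), (a *: d + e), (a * m + k); split.
      exact: (submodP a AS Ax Ay).
    rewrite -[LHS]/(a *: (x + m *: w) + (y + k *: w), a *: (d + m *: d1) + (e + k *: d1)).
    by rewrite !scalerDr !scalerDl !scalerA !addrA;
       congr pair; rewrite -!addrA; congr (_ + _); rewrite addrCA.
  by exists d1, 0, 0, 1; rewrite !scale1r !add0r; split=> //; exact: (submod0 AS).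
have [|h hP] := @Hom_of_relation _ W D (fun w d => A (w, d)) Atot A0.
  by move=> a x x' y y' Ax Ay; exact: (submodP a AS Ax Ay).
exists h; apply: HomP => v; apply: Afun (hP _) _.
by apply: G0A; exists v.
Qed.

(* The divisible hull of U is the quotient of Q^(U) by the kernel of Z^(U) -> U. *)
Lemma embed_int_injective (U : lmodType int) :
  exists (D : lmodType int) (j : Hom U D), injective_module D /\ injective j.
Proof.
pose Q : lmodType int := zmodule (freemod rat U).
pose aug : Hom (freemod int U) U := free_lift (fun x : U => x) : {linear _ -> _}.
pose io : Hom (freemod int U) Q :=
  free_lift (fun u : U => free_gen rat u : Q) : {linear _ -> _}.
have augE x : aug (free_gen int x) = x by exact: free_lift_gen.
have ioE x : io (free_gen int x) = free_gen rat x by exact: free_lift_gen.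
have ioval g x : free_val (io g : freemod rat U) x = ((free_val g x : int)%:~R : rat).
  have [a u v|e1 e1E] := @Hom_of_linear _ (freemod int U) (zmodule rat)
      (fun g => free_val (io g : freemod rat U) x).
    have fD (y z : freemod rat U) : free_val (y + z) x = free_val y x + free_val z x by [].
    have fM (y : freemod rat U) m : free_val (y *+ m) x = free_val y x *+ m.
      by elim: m => [//|m IH]; rewrite !mulrS fD IH.
    have fN (y : freemod rat U) : free_val (- y) x = - free_val y x by [].
    have fZ (y : freemod rat U) (m : int) : free_val (y *~ m) x = free_val y x *~ m.
      by case: m => m; rewrite ?NegzE /intmul ?fN fM.
    rewrite linearP -[LHS]/(free_val ((io u : freemod rat U) *~ a + (io v : freemod rat U)) x).
    by rewrite fD fZ.
  have [a u v|e2 e2E] := @Hom_of_linear _ (freemod int U) (zmodule rat)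
      (fun g => (free_val g x : int)%:~R : rat).
    have e (b m k : int) : (b * m + k)%:~R = m%:~R *~ b + k%:~R :> rat.
      by rewrite intrD intrM mulrzl.
    exact: e.
  rewrite -e1E -e2E; suff -> : e1 = e2 by [].
  apply: (@free_ext int U (zmodule rat)) => u; rewrite e1E e2E ioE /=.
  by case: (x == u).
have [|D [p [ps pE]]] := @quotient_exists _ Q [set x | exists g, aug g = 0 /\ io g = x].
  split; first by exists 0; rewrite !linear0.
  move=> a x y [g [g0 <-]] [h [h0 <-]].
  by exists (a *: g + h); rewrite !linearP g0 h0 scaler0 addr0.
have [a u v|j jE] := @Hom_of_linear _ U D (fun u => p (free_gen rat u : Q)).
  apply/eqP; rewrite -linearP -subr_eq0 -linearB; apply/eqP/pE.
  exists (free_gen int (a *: u + v) - (a *: free_gen int u + free_gen int v)).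
  split; first by rewrite linearB linearP !augE subrr.
  by rewrite linearB linearP !ioE.
exists D, j; split.
  apply: divisible_injective => d n n0; have [y <-] := ps d.
  exists (p ((n%:R^-1 : rat) *: (y : freemod rat U) : Q)).
  rewrite -linearZ /= scalezrE -[_ *~ _]/(_ *+ n) -scaler_nat scalerA divff ?scale1r //.
  by rewrite pnatr_eq0 -lt0n.
(* If [j u = 0], some [g] in the kernel of [aug] has the same image in [Q] as the generator [u]. By
   [ioval] it is that generator, whence [u = aug g = 0]. *)
suff j0 u : j u = 0 -> u = 0.
  move=> u v juv; apply/eqP; rewrite -subr_eq0; apply/eqP/j0.
  by rewrite linearB juv subrr.
rewrite jE => /pE[g [g0 eg]]; rewrite -[u]augE -g0; congr (aug _).
apply: val_inj; apply: funext => x; apply: (@intr_inj rat); rewrite -[RHS]ioval eg /=.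
by case: (x == u).
Qed.

(** * Restriction and coinduction of scalars *)

Section Coinduction.
Variables (S T : pzRingType) (phi : {rmorphism S -> T}).

Definition restr of {rmorphism S -> T} := fun U : lmodType T => U : Type.

Section Restr.
Variable U : lmodType T.
Local Notation rU := (restr phi U).
HB.instance Definition _ := GRing.Zmodule.on rU.
Definition restr_scale (s : S) (x : rU) : rU := phi s *: (x : U).
Lemma restr_scaleA a b v : restr_scale a (restr_scale b v) = restr_scale (a * b) v.
Proof. by rewrite /restr_scale scalerA rmorphM. Qed.
Lemma restr_scale1 : left_id 1 restr_scale.
Proof. by move=> x; rewrite /restr_scale rmorph1 scale1r. Qed.
Lemma restr_scaleDr : right_distributive restr_scale +%R.
Proof. by move=> a x y; rewrite /restr_scale scalerDr. Qed.
Lemma restr_scaleDl v : {morph restr_scale^~ v : a b / a + b}.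
Proof. by move=> a b; rewrite /restr_scale rmorphD scalerDl. Qed.
HB.instance Definition _ := GRing.Zmodule_isLmodule.Build S rU
  restr_scaleA restr_scale1 restr_scaleDr restr_scaleDl.
End Restr.

Lemma restr_scaleE (U : lmodType T) (s : S) (x : restr phi U) :
  s *: x = (phi s *: (x : U)).
Proof. by []. Qed.

Lemma restr_hom (U V : lmodType T) (f : Hom U V) :
  exists g : Hom (restr phi U) (restr phi V), forall x, g x = f x.
Proof. by apply: Hom_of_linear => a x y; rewrite !restr_scaleE linearP. Qed.

Variable E : lmodType S.

(** The coinduced module, right adjoint to restriction of scalars; [T] will act by right
    multiplication on the argument. *)
Definition coind : Type := Hom (restr phi (T^o : lmodType T)) E.
Local Notation cE := coind.
HB.instance Definition _ := GRing.Zmodule.on cE.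

Lemma coind_mul_subproof (t : T) :
  linear (fun x : restr phi (T^o : lmodType T) => (x : T) * t : restr phi (T^o : lmodType T)).
Proof.
by move=> a x y; rewrite /= !restr_scaleE -[in LHS]/((phi a * x + y) * t) mulrDl -mulrA.
Qed.

Definition coind_mul (t : T) : Hom (restr phi (T^o : lmodType T)) (restr phi (T^o : lmodType T)) :=
  HB.pack (fun x : restr phi (T^o : lmodType T) => (x : T) * t : restr phi (T^o : lmodType T))
   (GRing.isLinear.Build S _ _ *:%R _ (coind_mul_subproof t)).

Definition coind_scale (t : T) (f : cE) : cE := HomC (coind_mul t) f.
Lemma coind_scaleA a b v : coind_scale a (coind_scale b v) = coind_scale (a * b) v.
Proof. by apply: HomP => x /=; rewrite mulrA. Qed.
Lemma coind_scale1 : left_id 1 coind_scale.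
Proof. by move=> f; apply: HomP => x /=; rewrite mulr1. Qed.
Lemma coind_scaleDr : right_distributive coind_scale +%R.
Proof. by move=> a f g; apply: HomP. Qed.
Lemma coind_scaleDl v : {morph coind_scale^~ v : a b / a + b}.
Proof. by move=> a b; apply: HomP => x /=; rewrite -linearD mulrDr. Qed.
HB.instance Definition _ := GRing.Zmodule_isLmodule.Build T cE
  coind_scaleA coind_scale1 coind_scaleDr coind_scaleDl.

Lemma coind_adj (U : lmodType T) (f : Hom (restr phi U) E) :
  exists g : Hom U cE, forall u x, (g u : Hom _ _) x = f ((x : T) *: (u : U)).
Proof.
have fu u : exists g : cE, forall x, (g : Hom _ _) x = f ((x : T) *: (u : U)).
  apply: Hom_of_linear => a x y; rewrite -linearP; congr (f _).
  by rewrite !restr_scaleE -[in LHS]/((phi a * x + y) *: u) scalerDl scalerA.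
have [g gP] := boolp.choice fu.
have [a x y|h hE] := @Hom_of_linear _ U cE g; last by exists h => u x; rewrite hE.
apply: HomP => t; rewrite -[RHS]/((g x : Hom _ _) (t * a) + (g y : Hom _ _) t) !gP.
by rewrite scalerDr scalerA -linearD.
Qed.

(** Evaluation at 1 turns a map into the coinduced module into an [S]-linear map to [E]. This
    extends by injectivity of [E] and is transposed back by [coind_adj]. *)
Lemma coind_injective : injective_module E -> injective_module cE.
Proof.
move=> Ei V W j g ji; have [j' j'E] := restr_hom j.
have [a x y|g1 g1E] := @Hom_of_linear _ (restr phi V) E (fun v => (g v : Hom _ _) (1 : T)).
  rewrite restr_scaleE linearP.
  rewrite -[LHS]/((g x : Hom _ _) (1 * phi a) + (g y : Hom _ _) 1).
  rewrite -linearZ; congr ((g x : Hom _ _) _ + _).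
  by rewrite mul1r -[RHS]/(phi a * 1) mulr1.
have [|h1 h1E] := Ei _ _ j' g1; first by move=> x y; rewrite !j'E => /ji.
have [h hE] := coind_adj h1; exists h; apply: HomP => v; apply: HomP => x.
rewrite -[LHS]/((h (j v) : Hom _ _) x) hE -linearZ -j'E.
rewrite -[LHS]/(HomC j' h1 _) h1E g1E linearZ.
by rewrite -[LHS]/((g v : Hom _ _) (1 * x)) mul1r.
Qed.

End Coinduction.

Lemma coind_embed (S T : pzRingType) (phi : {rmorphism S -> T}) (U : lmodType T)
    (E : lmodType S) (j : Hom (restr phi U) E) : injective j ->
  exists g : Hom U (coind phi E), injective g.
Proof.
move=> ji; have [g gE] := coind_adj j; exists g => u v guv.
apply: ji; have := gE u (1 : T); rewrite guv gE.
by rewrite !scale1r.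
Qed.

Lemma embed_injective (T : pzRingType) (U : lmodType T) :
  exists (D : lmodType T) (j : Hom U D), injective_module D /\ injective j.
Proof.
pose phi : {rmorphism int -> T} := intmul 1.
have [D [j [Di ji]]] := embed_int_injective (restr phi U).
by have [g gi] := coind_embed ji; exists (coind phi D), g; split=> //; apply: coind_injective.
Qed.

(** * Finitely generated submodules *)

Section Span.
Variable L : pzRingType.
Implicit Types U V W : lmodType L.

(** Recursion on the list suits induction on generators; [fingenP] compares it with the indexed sums
    of [fingen]. *)
Fixpoint span U (s : seq U) : set U :=
  if s is u :: s' then [set x | exists a y, span s' y /\ x = a *: u + y]
  else [set 0].

Lemma span_submod U (s : seq U) : is_submod (span s).
Proof.
elim: s => [|u s IH] /=; first by split=> // a x y -> ->; rewrite scaler0 addr0.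
split; first by exists 0, 0; rewrite scale0r addr0; split=> //; exact: submod0 IH.
move=> a _ _ [b [x [Sx ->]]] [c [y [Sy ->]]].
exists (a * b + c), (a *: x + y); split; first exact: submodP.
by rewrite scalerDr scalerDl scalerA -!addrA; congr (_ + _); rewrite addrCA.
Qed.

Lemma span_mem U (s : seq U) x : x \in s -> span s x.
Proof.
elim: s => [//|u s IH]; rewrite in_cons => /orP[/eqP ->|/IH Sx] /=.
  by exists 1, 0; rewrite scale1r addr0; split=> //; exact: submod0 (span_submod s).
by exists 0, x; rewrite scale0r add0r.
Qed.

Lemma span_min U (s : seq U) (S : set U) : is_submod S -> (forall x, x \in s -> S x) ->
  span s `<=` S.
Proof.
move=> SP; elim: s => [_ x ->|u s IH sS x [a [y [sy ->]]]]; first exact: submod0.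
by apply: submodP; [| apply: sS; rewrite mem_head|
  apply: IH => // z zs; apply: sS; rewrite in_cons zs orbT].
Qed.

Lemma span_sub U (s t : seq U) : {subset s <= t} -> span s `<=` span t.
Proof. by move=> st; apply: span_min (span_submod t) _ => x /st /span_mem. Qed.

Definition is_fg_submod U (S : set U) : Prop := exists s, S = span s.

Lemma fg_submod_image U V (f : Hom U V) (S : set U) : is_fg_submod S -> is_fg_submod (f @` S).
Proof.
case=> s ->; exists (map f s); elim: s => [|u s IH] /=.
  by apply/seteqP; split=> [_ [x -> <-]|x ->]; [rewrite linear0|exists 0; rewrite ?linear0].
rewrite -IH; apply/seteqP; split.
  by move=> _ [_ [a [y [Sy ->]]] <-]; exists a, (f y); rewrite linearP; split=> //; exists y.
by move=> _ [a [_ [[y Sy <-] ->]]]; exists (a *: u + y); rewrite ?linearP //; exists a, y.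
Qed.

(** Lifts of generators of the image, together with generators of the kernel, generate [S]. *)
Lemma fg_submod_ext U V (f : Hom U V) (S : set U) : is_submod S ->
  is_fg_submod (f @` S) -> is_fg_submod (S `&` [set x | f x = 0]) -> is_fg_submod S.
Proof.
move=> SP [s es] [t et].
have [s' [s'S es']] : exists s', (forall x, x \in s' -> S x) /\ map f s' = s.
  have : forall y, y \in s -> exists2 x, S x & f x = y.
    by move=> y /span_mem; rewrite -es => -[x Sx <-]; exists x.
  elim: (s) => [|y l IH] ly; first by exists [::].
  have [|l' [l'S <-]] := IH; first by move=> z zl; apply: ly; rewrite in_cons zl orbT.
  have [x Sx <-] := ly y (mem_head _ _).
  by exists (x :: l'); split=> // z; rewrite in_cons => /orP[/eqP ->|/l'S].
exists (s' ++ t); apply/seteqP; split; last first.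
  apply: span_min => // x; rewrite mem_cat => /orP[/s'S //|/span_mem].
  by rewrite -et => -[].
move=> x Sx.
have [y sy fy] : exists2 y, span s' y & f y = f x.
  have : span s (f x) by rewrite -es; exists x.
  rewrite -es'; elim: (s') (f x) => [z -> | u l IH z [a [w [lw ->]]]] /=.
    by exists 0; rewrite ?linear0.
  by have [y ly <-] := IH w lw; exists (a *: u + y); rewrite ?linearP //; exists a, y.
have Sy : S y by apply: (span_min SP s'S).
rewrite -(subrK y x); apply: submodD; first exact: span_submod.
  apply: (@span_sub _ t); first by move=> z zt; rewrite mem_cat zt orbT.
  by rewrite -et; split; [apply: submodB|rewrite /= linearB fy subrr].
by apply: span_sub sy => z zs; rewrite mem_cat zs.
Qed.

Lemma fg_submod_add U (S T : set U) : is_fg_submod S -> is_fg_submod T ->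
  is_fg_submod [set x | exists y z, [/\ S y, T z & x = y + z]].
Proof.
move=> [s ->] [t ->]; exists (s ++ t); apply/seteqP; split.
  move=> _ [y [z [sy tz ->]]]; apply: submodD; first exact: span_submod.
    by apply: span_sub sy => x xs; rewrite mem_cat xs.
  by apply: span_sub tz => x xs; rewrite mem_cat xs orbT.
have s0 := submod0 (span_submod s); have t0 := submod0 (span_submod t).
apply: span_min.
  split; first by exists 0, 0; rewrite addr0.
  move=> a _ _ [x [y [sx ty ->]]] [x' [y' [sx' ty' ->]]].
  exists (a *: x + x'), (a *: y + y'); split; last by rewrite scalerDr addrACA.
    exact: submodP (span_submod s) sx sx'.
  exact: submodP (span_submod t) ty ty'.
move=> x; rewrite mem_cat => /orP[/span_mem xs|/span_mem xt].
  by exists x, 0; rewrite addr0.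
by exists 0, x; rewrite add0r.
Qed.

Lemma fg_submod_span U (S : set U) : is_fg_submod S -> is_submod S.
Proof. by case=> s ->; exact: span_submod. Qed.

Lemma fingenP U : fingen U <-> is_fg_submod [set: U].
Proof.
split=> [[s sP]|[s sP]].
  exists s; apply/seteqP; split=> // x _; have [c ->] := sP x.
  elim/big_ind: _ => [|y z|i _]; first exact: submod0 (span_submod s).
    exact: submodD (span_submod s).
  by apply: submodZ (span_submod s) _; apply: span_mem; apply: mem_nth.
exists s => x; have : span s x by rewrite -sP.
elim: s {sP} x => [x ->|u s IH x [a [y [/IH[c ->] ->]]]].
  by exists (fun=> 0); rewrite big_ord0.
exists (fun i => if unlift ord0 i is Some j then c j else a).
rewrite big_ord_recl unlift_none; congr (_ + _); apply: eq_bigr => i _.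
by rewrite liftK.
Qed.

Lemma fingen_epi U V (f : Hom U V) : (forall y, exists x, f x = y) -> fingen U -> fingen V.
Proof.
move=> fs /fingenP /(fg_submod_image f) H; apply/fingenP; move: H.
suff -> : f @` [set: U] = [set: V] by [].
by apply/seteqP; split=> // y _; have [x <-] := fs y; exists x.
Qed.

End Span.

(** * Modules over commutative artinian rings *)

Lemma antitone_le (T : Type) (S : nat -> set T) :
  (forall k, S k.+1 `<=` S k) -> forall k m, (k <= m)%N -> S m `<=` S k.
Proof.
move=> Sd k m /subnK <-; elim: (m - k)%N => [//|i IH] x.
by rewrite addSn => /Sd /IH.
Qed.

Lemma monotone_le (T : Type) (S : nat -> set T) :
  (forall k, S k `<=` S k.+1) -> forall k m, (k <= m)%N -> S k `<=` S m.
Proof.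
move=> Sd k m /subnK <-; elim: (m - k)%N => [//|i IH] x /IH.
by rewrite addSn => /Sd.
Qed.

(** * Chain conditions on submodules *)

Section ChainConditions.
Variable L : pzRingType.
Implicit Types U : lmodType L.

Definition dcc U (S : set U) : Prop :=
  forall T : nat -> set U, (forall k, is_submod (T k)) -> (forall k, T k `<=` S) ->
    (forall k, T k.+1 `<=` T k) ->
    exists N, forall k, (N <= k)%N -> T k = T N.

Definition noetherian U (S : set U) : Prop :=
  forall T : set U, is_submod T -> T `<=` S -> is_fg_submod T.

Lemma dcc_min U (S T0 : set U) (P : set U -> Prop) :
  dcc S -> is_submod T0 -> T0 `<=` S -> P T0 ->
  exists T, [/\ is_submod T, T `<=` S, P T &
    forall T', is_submod T' -> T' `<=` T -> P T' -> T' = T].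
Proof.
move=> Sd T0s T0S PT0; apply: contrapT => nT.
pose X := {T : set U | [/\ is_submod T, T `<=` S & P T]}.
pose x0 : X := exist _ T0 (And3 T0s T0S PT0).
have [[T [Ts TS PT]]|f [_ fP]] :=
    @dependent_choice X (fun A B => sval B `<=` sval A /\ sval B <> sval A) x0.
  apply: contrapT => nB; apply: nT; exists T; split=> // T' T's T'T PT'.
  apply: contrapT => nT'T; apply: nB.
  by exists (exist _ T' (And3 T's (subset_trans T'T TS) PT')).
have [k|k|k|N NP] := Sd (fun k => sval (f k)).
- by case: (f k) => ? [].
- by case: (f k) => ? [].
- by have [] := fP k.
by have [_] := fP N; rewrite (NP N.+1).
Qed.

Lemma noeth_acc U (S : set U) (T : nat -> set U) : noetherian S ->
  (forall k, is_submod (T k)) -> (forall k, T k `<=` S) ->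
  (forall k, T k `<=` T k.+1) ->
  exists N, forall k, (N <= k)%N -> T k = T N.
Proof.
move=> Sn Ts TS Tm; have Tle := monotone_le Tm.
have [||s sE] := Sn (\bigcup_k T k).
- split; first by exists 0%N => //; exact: submod0.
  move=> a x y [k _ Tx] [m _ Ty]; exists (maxn k m) => //; apply: submodP => //.
    by apply: Tle Tx; rewrite leq_maxl.
  by apply: Tle Ty; rewrite leq_maxr.
- by move=> x [k _ /TS].
have [N sN] : exists N, forall x, x \in s -> T N x.
  have : forall x, x \in s -> exists k, T k x.
    by move=> x /span_mem; rewrite -sE => -[k _ Tx]; exists k.
  elim: (s) => [|x l IH] lT; first by exists 0%N.
  have [|N lN] := IH; first by move=> y yl; apply: lT; rewrite in_cons yl orbT.
  have [k Tx] := lT x (mem_head _ _); exists (maxn N k) => y.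
  rewrite in_cons => /orP[/eqP ->|/lN Ty].
    by apply: Tle Tx; rewrite leq_maxr.
  by apply: Tle Ty; rewrite leq_maxl.
exists N => k Nk; apply/seteqP; split; last exact: Tle.
by move=> x Tx; apply: (span_min (Ts N) sN); rewrite -sE; exists k.
Qed.

Lemma noeth_max U (S T0 : set U) (P : set U -> Prop) :
  noetherian S -> is_submod T0 -> T0 `<=` S -> P T0 ->
  exists T, [/\ is_submod T, T `<=` S, P T &
    forall T', is_submod T' -> T' `<=` S -> T `<=` T' -> P T' -> T' = T].
Proof.
move=> Sd T0s T0S PT0; apply: contrapT => nT.
pose X := {T : set U | [/\ is_submod T, T `<=` S & P T]}.
pose x0 : X := exist _ T0 (And3 T0s T0S PT0).
have [[T [Ts TS PT]]|f [_ fP]] :=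
    @dependent_choice X (fun A B => sval A `<=` sval B /\ sval B <> sval A) x0.
  apply: contrapT => nB; apply: nT; exists T; split=> // T' T's T'S TT' PT'.
  apply: contrapT => nT'T; apply: nB.
  by exists (exist _ T' (And3 T's T'S PT')).
have [k|k|k|N NP] := noeth_acc (T := fun k => sval (f k)) Sd.
- by case: (f k) => ? [].
- by case: (f k) => ? [].
- by have [] := fP k.
by have [_] := fP N; rewrite (NP N.+1).
Qed.

Lemma image_submod U V (f : Hom U V) (S : set U) : is_submod S -> is_submod (f @` S).
Proof.
move=> SP; split; first by exists 0; rewrite ?linear0 //; exact: submod0.
by move=> a _ _ [x Sx <-] [y Sy <-]; exists (a *: x + y); rewrite ?linearP //; exact: submodP.
Qed.

Lemma ker_submod U V (f : Hom U V) (S : set U) : is_submod S -> is_submod (S `&` [set x | f x = 0]).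
Proof.
move=> SP; split; first by split; [exact: submod0|rewrite /= linear0].
move=> a x y [Sx fx] [Sy fy]; split; first exact: submodP.
by rewrite /= linearP fx fy scaler0 addr0.
Qed.

(** The maps in [fs] jointly embed [S] in a finite power of [V]; they are split off one at a time by
    [fg_submod_ext]. *)
Lemma fg_submod_embed U V (fs : seq (Hom U V)) (S : set U) : noetherian [set: V] -> is_submod S ->
  (forall x, S x -> (forall f, f \in fs -> f x = 0) -> x = 0) -> is_fg_submod S.
Proof.
move=> Vn; elim: fs S => [|f fs IH] S SP S0.
  exists [::]; apply/seteqP; split=> [x Sx|x ->]; last exact: submod0.
  by apply: S0.
apply: (fg_submod_ext SP) (Vn _ (image_submod f SP) _) (IH _ (ker_submod f SP) _) => //.
move=> x [Sx fx] fsx; apply: S0 => // g; rewrite in_cons => /orP[/eqP -> //|].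
exact: fsx.
Qed.

End ChainConditions.

Section Artinian.
Variable R : comPzRingType.
Hypothesis Rart : artinian R.
Implicit Types U : lmodType R.

Lemma homothety U (r : R) : exists f : Hom U U, forall x, f x = r *: x.
Proof. by apply: Hom_of_linear => a x y; rewrite scalerDr !scalerA mulrC. Qed.

(** The ideals generated by the powers of [r] stabilise. In consequence an element outside a prime
    ideal is invertible modulo it. *)
Lemma artinian_power (r : R) : exists m s, r ^+ m * (1 - r * s) = 0.
Proof.
have [k|k|N NP] := @Rart (fun k => [set x | exists s, x = r ^+ k * s]).
- split; first by exists 0; rewrite mulr0.
    by move=> _ _ [s ->] [t ->]; exists (s + t); rewrite mulrDr.
  by move=> a _ [s ->]; exists (a * s); rewrite mulrCA.
- by move=> _ [s ->]; exists (r * s); rewrite exprSr mulrA.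
have : [set x | exists s, x = r ^+ N.+1 * s] (r ^+ N).
  by rewrite (NP N.+1) //=; exists 1; rewrite mulr1.
move=> [s es]; exists N, s; rewrite mulrBr mulr1 mulrA -exprSr -es subrr //.
Qed.

(** Two nested submodules of [span (u :: s)] are equal once they have the same ideal of coefficients
    of [u] modulo [span s] and the same intersection with [span s]. *)
Lemma dcc_span U (s : seq U) : dcc (span s).
Proof.
elim: s => [|u s IH] T Ts TS Td.
  exists 0%N => k _; apply/seteqP; split=> x Tx; first by rewrite (TS k _ Tx); exact: submod0.
  by rewrite (TS 0%N _ Tx); exact: submod0.
have Tle := antitone_le Td.
have [k|k|N1 N1P] := @Rart (fun k => [set r | exists w, span s w /\ T k (r *: u + w)]).
- split.
  + by exists 0; rewrite scale0r addr0; split; [exact: submod0 (span_submod s)|exact: submod0].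
  + move=> a b [w [sw Tw]] [v [sv Tv]]; exists (w + v); split.
      exact: submodD (span_submod s) sw sv.
    by rewrite scalerDl addrACA; exact: submodD.
  + move=> a b [w [sw Tw]]; exists (a *: w); split.
      exact: submodZ (span_submod s) sw.
    by rewrite -scalerA -scalerDr; exact: submodZ.
- by move=> r [w [sw /Td]]; exists w.
have [k|k|k|N2 N2P] := IH (fun k => T k `&` span s).
- split; first by split; [exact: submod0|exact: submod0 (span_submod s)].
  by move=> a x y [Tx sx] [Ty sy]; split; [exact: submodP|exact: submodP (span_submod s) sx sy].
- by move=> x [].
- by move=> x [/Td].
exists (maxn N1 N2) => k; rewrite geq_max => /andP[N1k N2k].
set N := maxn N1 N2.
apply/seteqP; split; first by apply: Tle; rewrite geq_max N1k.
move=> x TNx; have [a [y [sy ex]]] := TS _ _ TNx.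
have : [set r | exists w, span s w /\ T k (r *: u + w)] a.
  rewrite (N1P k N1k) -(N1P N (leq_maxl _ _)); exists y; split=> //.
  by rewrite -ex.
move=> [w [sw Tw]].
have : (T k `&` span s) (y - w).
  rewrite (N2P k N2k) -(N2P N (leq_maxr _ _)); split; last exact: submodB (span_submod s) _ _.
  have -> : y - w = x - (a *: u + w) by rewrite ex opprD addrA [_ + y]addrC addrK.
  apply: submodB => //; apply: Tle Tw.
  by rewrite geq_max N1k.
move=> [Tyw _].
have -> : x = (y - w) + (a *: u + w) by rewrite addrCA subrK.
exact: submodD.
Qed.

(* A minimal submodule I that is not finitely generated: each scalar kills I or
   acts bijectively on it, so I is an infinite-dimensional vector space over the
   field R / ann I, and the tails of an independent sequence contradict [dcc]. *)
Lemma dcc_noeth U (S : set U) : dcc S -> noetherian S.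
Proof.
move=> Sd T0 T0s T0S; apply: contrapT => nT0.
have [I [Is IS nI Imin]] := @dcc_min _ _ _ _ (fun T => ~ is_fg_submod T) Sd T0s T0S nT0.
have act (r : R) : (forall x, I x -> r *: x = 0) \/
    exists s, forall x, I x -> s *: (r *: x) = x.
  have [f fE] := homothety U r.
  have [fI|nfI] := pselect (is_fg_submod (f @` I)).
    left=> x Ix; have nK : ~ is_fg_submod (I `&` [set x | f x = 0]).
      by move=> /(fg_submod_ext Is fI).
    have := Imin _ (ker_submod f Is) (@subIsetl _ _ _) nK.
    by move=> e; move: Ix; rewrite -[in X in X -> _]e => -[_] /=; rewrite fE.
  right; have onto1 x : I x -> exists2 y, I y & r *: y = x.
    have e : f @` I = I.
      apply: Imin nfI; first exact: image_submod.
      by move=> _ [y Iy <-]; rewrite fE; apply: submodZ.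
    by rewrite -[in X in X -> _]e => -[y Iy <-]; exists y; rewrite // fE.
  have onto m : forall x, I x -> exists2 y, I y & r ^+ m *: y = x.
    elim: m => [|m IH] x Ix; first by exists x; rewrite // expr0 scale1r.
    have [y Iy <-] := onto1 x Ix; have [z Iz <-] := IH y Iy.
    by exists z; rewrite // scalerA exprS.
  have [m [s rs]] := artinian_power r; exists s => x Ix.
  have [y Iy <-] := onto m x Ix.
  apply/esym/eqP; rewrite -subr_eq0 !scalerA -scalerBl.
  have -> : r ^+ m - s * r * r ^+ m = r ^+ m * (1 - r * s).
    by rewrite mulrBr mulr1 [r * s]mulrC [s * r * _]mulrC.
  by rewrite rs scale0r.
(* The inclusion is a premise inside the relation so that every list has a successor, as dependent
   choice requires; the empty list is a dummy value. *)
have next (l : seq U) : exists l', span l `<=` I ->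
    exists x, [/\ l' = x :: l, I x & ~ span l x].
  have [sl|nsl] := pselect (span l `<=` I); last by exists [::].
  have [x [Ix nx]] : exists x, I x /\ ~ span l x.
    apply: contrapT => nx; apply: nI; exists l; apply/seteqP; split=> // x Ix.
    by apply: contrapT => nlx; apply: nx; exists x.
  by exists (x :: l) => _; exists x.
have [f [f0 fP]] := dependent_choice [::] next.
have fI k : span (f k) `<=` I.
  elim: k => [|k IH]; first by rewrite f0 => x ->; exact: submod0.
  have [x [-> Ix _]] := fP k IH.
  by move=> _ [a [y [/IH Iy ->]]]; exact: submodP.
have [x xP] := boolp.choice (fun k => fP k (fI k)).
pose tl k m := [seq x i | i <- iota k m].
have indep m k z : span (f k) z -> span (tl k m) z -> z = 0.
  elim: m k z => [|m IH] k z fz //= [a [w [tw ez]]].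
  have [fk Ix nfx] := xP k.
  have w0 : w = 0.
    apply: IH tw; rewrite fk; exists (- a), z; split=> //.
    by rewrite ez scaleNr addKr.
  have {}ez : z = a *: x k by rewrite ez w0 addr0.
  have [a0|[s sa]] := act a; first by rewrite ez a0.
  case: nfx; rewrite -(sa _ Ix) -ez; exact: submodZ (span_submod _) fz.
have [k|k|k|N NP] := Sd (fun k => [set z | exists m, span (tl k m) z]).
- split; first by exists 0%N.
  move=> a y z [m my] [m' mz]; exists (maxn m m').
  have sub i j : (i <= j)%N -> {subset tl k i <= tl k j}.
    move=> ij; move=> t /mapP[n]; rewrite mem_iota => /andP[kn nk] ->.
    by apply: map_f; rewrite mem_iota kn (leq_trans nk) // leq_add2l.
  apply: (submodP _ (span_submod _)); [move: my|move: mz]; apply: span_sub; apply: sub.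
    exact: leq_maxl.
  exact: leq_maxr.
- move=> z [m mz]; apply: IS; apply: (span_min Is _ mz) => y /mapP[i _ ->].
  by have [] := xP i.
- move=> z [m mz]; exists m.+1; apply: span_sub mz => t /mapP[i].
  by rewrite mem_iota => /andP[ki im] ->; apply: map_f; rewrite mem_iota; lia.
have : [set z | exists m, span (tl N m) z] (x N).
  by exists 1%N; apply: span_mem; rewrite mem_head.
rewrite -(NP N.+1) // => -[m mx].
have [fN _ nfx] := xP N; apply: nfx.
rewrite (indep m N.+1 (x N)) //; first exact: submod0 (span_submod _).
by rewrite fN; apply: span_mem; rewrite mem_head.
Qed.

Lemma fg_submod_dcc U (S : set U) : is_fg_submod S -> dcc S.
Proof. by case=> s ->; exact: dcc_span. Qed.

Lemma fg_submod_noeth U (S : set U) : is_fg_submod S -> noetherian S.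
Proof. by move/fg_submod_dcc/dcc_noeth. Qed.

Lemma ideals_noeth : noetherian [set: (R^o : lmodType R)].
Proof.
apply: fg_submod_noeth; exists [:: 1 : R^o]; apply/seteqP; split=> // x _.
by exists x, 0; split=> //; rewrite addr0 -[RHS]/(x * 1) mulr1.
Qed.

(* Writing E[I] for the elements of E killed by I, an ideal I maximal among those for which
   E[I] is not finitely generated is prime, by the exact sequences
   0 -> E[I+a] -> E[I] -> E[I+b] for ab in I; so R / I is a field and
   essentiality puts E[I] inside U. *)
Lemma essential_fg_submod (Q : lmodType R) (U E : set Q) : is_fg_submod U -> is_submod E ->
  (forall e, E e -> e <> 0 -> exists r, r *: e <> 0 /\ U (r *: e)) -> is_fg_submod E.
Proof.
move=> Uf Es ess; apply: contrapT => nE; have Us := fg_submod_span Uf.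
pose ann (I : set R^o) : set Q := [set e | E e /\ forall r, I r -> r *: e = 0].
have annP I : is_submod (ann I).
  split; first by split; [exact: submod0|move=> r _; rewrite scaler0].
  move=> a x y [Ex Ix] [Ey Iy]; split; first exact: submodP.
  move=> r Ir; rewrite scalerDr scalerA mulrC -scalerA Ix // Iy //.
  by rewrite scaler0 addr0.
have [|||I [Is _ nI Imax]] := @noeth_max _ R^o _ [set 0] (fun I => ~ is_fg_submod (ann I)) ideals_noeth.
- by split=> // a x y -> ->; rewrite scaler0 addr0.
- by [].
- suff -> : ann [set 0] = E by [].
  by apply/seteqP; split=> x; [case|split=> // r ->; rewrite scale0r].
have annD a : ~ I a -> is_fg_submod (ann I `&` [set e | a *: e = 0]).
  move=> nIa; apply: contrapT => nf; apply: (nIa).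
  pose J : set R^o := [set x | exists i c, I i /\ x = i + c * a].
  have IJ : I `<=` J by move=> i Ii; exists i, 0; rewrite mul0r addr0.
  have <- : J = I.
    apply: Imax => //.
      split; first by apply: IJ; exact: submod0.
      move=> b _ _ [i [c [Ii ->]]] [j [d [Ij ->]]]; exists (b *: i + j), (b * c + d).
      split; first exact: submodP.
      by rewrite -[b *: _]/(b * _) mulrDr mulrDl !addrA mulrA; congr (_ + _); rewrite addrAC.
    suff -> : ann J = ann I `&` [set e | a *: e = 0] by [].
    apply/seteqP; split=> e.
      move=> [Ee Je]; split; first by split=> // r /IJ; apply: Je.
      by apply: Je; exists 0, 1; split; [exact: (submod0 Is)|rewrite mul1r add0r].
    move=> [[Ee Ie] ae]; split=> // _ [i [c [Ii ->]]].
    by rewrite scalerDl Ie // -scalerA ae scaler0 addr0.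
  by exists 0, 1; split; [exact: (submod0 Is)|rewrite mul1r add0r].
have prime a b : I (a * b) -> I a \/ I b.
  move=> Iab; apply: contrapT => /not_orP[na nb]; apply: nI.
  have [f fE] := homothety Q a.
  apply: (@fg_submod_ext _ _ _ f) => //; last first.
    suff -> : [set x | f x = 0] = [set x | a *: x = 0] by apply: annD.
    by apply/seteqP; split=> x /=; rewrite fE.
  apply: (fg_submod_noeth (annD b nb)); first exact: image_submod.
  move=> _ [e [Ee Ie] <-]; rewrite fE; split; last first.
    by rewrite /= scalerA mulrC Ie.
  split; first exact: submodZ.
  by move=> r Ir; rewrite scalerA mulrC -scalerA Ie // scaler0.
have unit r : ~ I r -> exists s, I (1 - r * s).
  move=> nr; have [m [s rs]] := artinian_power r; exists s.
  have : I (r ^+ m * (1 - r * s)) by rewrite rs; exact: (submod0 Is).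
  elim: m {rs} => [|m IH]; first by rewrite expr0 mul1r.
  by rewrite exprS -mulrA => /prime[].
apply: nI; apply: (fg_submod_noeth Uf) => // e [Ee Ie].
have [->|/eqP e0] := eqVneq e 0; first exact: submod0.
have [r [re Ure]] := ess e Ee e0.
have [|s rs] := unit r; first by move=> /Ie.
have -> : e = s *: (r *: e); last exact: submodZ.
apply/eqP; rewrite -subr_eq0 scalerA mulrC -[X in X - _]scale1r -scalerBl.
by rewrite Ie.
Qed.

End Artinian.

(** * Artin algebras *)

Section Hull.
Variable L : pzRingType.
Implicit Types U V W Q : lmodType L.

Lemma submodule_exists U (S : set U) : is_submod S ->
  exists (V : lmodType L) (j : Hom V U), injective j /\ forall x, S x <-> exists v, j v = x.
Proof.
move=> SP; have [C [p [ps pE]]] := quotient_exists SP.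
have [ji _ jE] := exact3_ker ps.
by exists (kermod p), (ker_incl p); split=> // x; rewrite -pE.
Qed.

Definition essential U (S T : set U) : Prop :=
  forall e, T e -> e <> 0 -> exists r : L, r *: e <> 0 /\ S (r *: e).

Lemma max_essential Q (S : set Q) : is_submod S ->
  exists A, [/\ is_submod A, S `<=` A, essential S A &
    forall B, is_submod B -> A `<=` B -> essential S B -> B = A].
Proof.
move=> SP; have [||A [[As Ae] SA Amax]] := @Zorn_above _ (fun A => is_submod A /\ essential S A) S.
- by split=> // e Se e0; exists 1; rewrite scale1r.
- move=> F [X0 FX0] sF totF; split; last first.
    by move=> e [X FX Xe]; have [[_ +] _] := sF X FX; apply.
  split; first by exists X0 => //; have [[/submod0]] := sF X0 FX0.
  move=> a x y [X FX Xx] [Y FY Yy]; have [XY|YX] := totF X Y FX FY.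
    by exists Y => //; have [[SY _] _] := sF Y FY; apply: submodP => //; apply: XY.
  by exists X => //; have [[SX _] _] := sF X FX; apply: submodP => //; apply: YX.
by exists A; split=> // B Bs AB Be; apply: Amax.
Qed.

Lemma max_complement Q (A : set Q) :
  exists C, [/\ is_submod C, forall x, C x -> A x -> x = 0 &
    forall B, is_submod B -> C `<=` B -> (forall x, B x -> A x -> x = 0) -> B = C].
Proof.
have [||C [[Cs CA] _ Cmax]] :=
    @Zorn_above _ (fun C => is_submod C /\ forall x, C x -> A x -> x = 0) [set (0 : Q)].
- by split=> //; split=> // a x y -> ->; rewrite scaler0 addr0.
- move=> F [X0 FX0] sF totF; split; last first.
    by move=> e [X FX Xe]; have [[_ +] _] := sF X FX; apply.
  split; first by exists X0 => //; have [[/submod0]] := sF X0 FX0.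
  move=> a x y [X FX Xx] [Y FY Yy]; have [XY|YX] := totF X Y FX FY.
    by exists Y => //; have [[SY _] _] := sF Y FY; apply: submodP => //; apply: XY.
  by exists X => //; have [[SX _] _] := sF X FX; apply: submodP => //; apply: YX.
by exists C; split=> // B Bs CB BA; apply: Cmax.
Qed.

(* [r] extends the projection of A + C onto A, where C is a maximal complement;
   its image is again essential over A, hence equal to A. *)
Lemma essential_retract Q (S A : set Q) : injective_module Q -> is_submod A -> S `<=` A ->
  essential S A ->
  (forall B, is_submod B -> A `<=` B -> essential S B -> B = A) ->
  exists r : Hom Q Q, (forall x, A (r x)) /\ forall x, A x -> r x = x.
Proof.
move=> Qi As SA Ae Amax; have [C [Cs CA Cmax]] := max_complement A.
have [|V [j [ji jE]]] := @submodule_exists Q [set x | exists a c, [/\ A a, C c & x = a + c]].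
  split; first by exists 0, 0; split; [exact: submod0|exact: submod0|rewrite addr0].
  move=> k _ _ [a [c [Aa Cc ->]]] [b [d [Ab Cd ->]]].
  exists (k *: a + b), (k *: c + d); split; [exact: submodP|exact: submodP|].
  by rewrite scalerDr addrACA.
have [v|y [Ay]|k x x' y y' [Ay Cy] [Ay' Cy']|g gP] :=
    @Hom_of_relation _ V Q (fun v y => A y /\ C (j v - y)).
- have [|a [c [Aa Cc e]]] := (jE (j v)).2; first by exists v.
  by exists a; rewrite e [a + c]addrC addrK.
- by rewrite linear0 sub0r => /(submodN Cs); rewrite opprK => Cy; apply: CA.
- split; first exact: submodP.
  by rewrite linearP opprD addrACA -scalerBr; apply: submodP.
have [r rE] := Qi _ _ j g ji.
have rj v : r (j v) = g v by rewrite -[LHS]/(HomC j r v) rE.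
have rA x : A x -> r x = x.
  move=> Ax; have /(jE x)[v vx] : [set x | exists a c, [/\ A a, C c & x = a + c]] x.
    by exists x, 0; split=> //; [exact: submod0|rewrite addr0].
  have [Ag Cg] := gP v; rewrite -vx rj; apply/esym/eqP; rewrite -subr_eq0; apply/eqP.
  by apply: CA => //; rewrite vx; exact: submodB.
have rC x : C x -> r x = 0.
  move=> Cx; have /(jE x)[v vx] : [set x | exists a c, [/\ A a, C c & x = a + c]] x.
    by exists 0, x; split=> //; [exact: submod0|rewrite add0r].
  have [Ag Cg] := gP v; rewrite -vx rj; apply: CA => //.
  have -> : g v = j v - (j v - g v) by rewrite opprB addrC subrK.
  by apply: submodB => //; rewrite vx.
have kC : [set x | r x = 0] = C.
  apply: Cmax => //.
    split; first by rewrite /= linear0.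
    by move=> a x y /= rx ry; rewrite linearP rx ry scaler0 addr0.
  by move=> x /= rx Ax; rewrite -(rA x Ax).
exists r; split=> // x.
suff <- : r @` [set: Q] = A by exists x.
apply: Amax.
- exact: image_submod.
- by move=> a Aa; exists a; rewrite ?rA.
move=> _ [q _ <-] rq.
(* If [C + L q] met [A] only in 0, maximality of [C] would put [q] in [C], where [r] vanishes. A
   nonzero [z] in the intersection equals [s *: r q], so essentiality at [z] gives a multiple of
   [r q] in [S]. *)
have [z [[c [s [Cc ez]]] Az z0]] :
    exists z, [/\ exists c (s : L), C c /\ z = c + s *: q, A z & z <> 0].
  apply: contrapT => nz; apply: rq.
  suff Cq : C q by exact: rC.
  pose B := [set z | exists c (s : L), C c /\ z = c + s *: q].
  have CB : C `<=` B by move=> c Cc; exists c, 0; rewrite scale0r addr0.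
  have <- : B = C.
    apply: Cmax => //.
      split; first by apply: CB; exact: submod0.
      move=> k _ _ [c [s [Cc ->]]] [d [t [Cd ->]]]; exists (k *: c + d), (k * s + t).
      split; first exact: submodP.
      by rewrite scalerDr scalerDl scalerA addrACA.
    by move=> y By Ay; apply: contrapT => y0; apply: nz; exists y.
  by exists 0, 1; rewrite scale1r add0r; split=> //; exact: submod0.
have zE : z = s *: r q by rewrite -(rA z Az) ez linearD linearZ rC // add0r.
have [t [tz Stz]] := Ae z Az z0; exists (t * s).
by rewrite -scalerA -zE.
Qed.

End Hull.

Section Artin.
Variable R : comPzRingType.
Hypothesis Rart : artinian R.

(* A maximal essential extension of U inside some injective module. *)
Lemma injective_hull (U : lmodType R) : fingen U ->
  exists (E : lmodType R) (j : Hom U E), [/\ fingen E, injective_module E & injective j].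
Proof.
move=> Uf; have [Q [i [Qi ii]]] := embed_injective U.
have iUs := image_submod i (conj I (fun _ _ _ _ _ => I) : is_submod [set: U]).
have [A [As UA Ae Amax]] := max_essential iUs.
have [r [rA rK]] := essential_retract Qi As UA Ae Amax.
have [E [j [ji jE]]] := submodule_exists As.
have Af : is_fg_submod A.
  apply: (@essential_fg_submod _ Rart Q (i @` [set: U])) => //.
  by apply: fg_submod_image; apply/fingenP.
have lift V (g : Hom V Q) : (forall x, A (g x)) -> exists h : Hom V E, HomC h j = g.
  move=> gA; have [v|y|a x x' y y'|h hP] := @Hom_of_relation _ V E (fun v e => j e = g v).
  - exact/jE.
  - by rewrite linear0 => jy; apply: ji; rewrite jy linear0.
  - by rewrite !linearP => -> ->.
  by exists h; apply: HomP.
have [k kE] : exists k : Hom U E, HomC k j = i by apply: lift => x; apply: UA; exists x.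
have iE x : i x = j (k x) by rewrite -kE.
exists E, k; split.
- apply/fingenP; apply: (@fg_submod_ext _ _ _ j) => //.
    suff -> : j @` [set: E] = A by [].
    by apply/seteqP; split=> [_ [e _ <-]|x /jE[e <-]]; [apply/jE; exists e|exists e].
  exists [::]; apply/seteqP; split=> [x [_ /= jx]|x ->]; last first.
    by split; rewrite //= linear0.
  by apply: ji; rewrite jx linear0.
- move=> V W f g fi; have [h hE] := Qi _ _ f (HomC g j) fi.
  have [|h' h'E] := lift _ (HomC h r); first by move=> x; exact: rA.
  exists h'; apply: HomP => v; apply: ji.
  rewrite -[LHS]/(HomC h' j (f v)) h'E -[LHS]/(r (HomC f h v)) hE rK //.
  by apply/jE; exists (g v).
- by move=> x y kxy; apply: ii; rewrite !iE kxy.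
Qed.

End Artin.

Section ArtinAlgebra.
Variable L : pzRingType.
Hypothesis Lart : artin_algebra L.
Implicit Types U V : lmodType L.


Section Base.
Variables (R : comPzRingType) (phi : {rmorphism R -> L}).
Hypothesis Rart : artinian R.
Hypothesis phiC : forall r x, phi r * x = x * phi r.
Hypothesis Lfg : exists s : seq L, forall x : L, exists c : 'I_(size s) -> R,
          x = \sum_(i < size s) phi (c i) * s`_i.

(** A cyclic [L]-module is an image of [L], which is finitely generated over [R]; the generators are
    treated one at a time. *)
Lemma restr_fingen U : fingen U <-> fingen (restr phi U).
Proof.
split; last by move=> [t tP]; exists t => x; have [c ->] := tP x; exists (fun i => phi (c i)).
have Lf : fingen (restr phi (L^o : lmodType L)) by exact: Lfg.
move=> /fingenP[t tP]; apply/fingenP.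
rewrite -[[set: _]]/([set: U]) tP; elim: t {tP} => [|u t IH].
  by exists [::].
have [a x y|f fE] := @Hom_of_linear R (restr phi (L^o : lmodType L)) (restr phi U)
    (fun x => (x : L) *: (u : U)).
  by rewrite !restr_scaleE -[in LHS]/((phi a * x + y) *: u) scalerDl scalerA.
move: Lf => /fingenP /(fg_submod_image f) /fg_submod_add /(_ IH).
suff -> : [set x | exists y z, [/\ (f @` setT) y, @span L U t z & x = y + z]] =
   @span L U (u :: t) by [].
apply/seteqP; split=> x.
  by move=> [_ [z [[a _ <-] tz ->]]]; exists a, z; split=> //; rewrite fE.
move=> [a [z [tz ->]]]; exists (a *: u), z; split=> //.
by exists a; rewrite ?fE.
Qed.

Lemma submodule_fingen U V (j : Hom V U) : injective j -> fingen U -> fingen V.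
Proof.
move=> ji /restr_fingen /fingenP Uf; apply/restr_fingen/fingenP.
have [j' j'E] := restr_hom phi j.
apply: (@fg_submod_embed _ _ _ [:: j']) (fg_submod_noeth Rart Uf) _ _ => //.
move=> x _ /(_ j' (mem_head _ _)); rewrite j'E => jx.
by apply: ji; rewrite jx linear0.
Qed.

(** Evaluation at finitely many generators of [L] embeds the coinduced module in a power of [E]; it
    is [R]-linear because the image of [phi] is central. *)
Lemma coind_fingen (E : lmodType R) : fingen E -> fingen (coind phi E).
Proof.
move=> /fingenP Ef; apply/restr_fingen/fingenP; have [s sP] := Lfg.
have ev (x : L) : exists f : Hom (restr phi (coind phi E)) E, forall g,
    f g = (g : Hom _ _) (x : restr phi (L^o : lmodType L)).
  apply: Hom_of_linear => a f g; rewrite -linearZ restr_scaleE.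
  rewrite -[LHS]/((f : Hom _ _) (x * phi a) + (g : Hom _ _) x).
  by rewrite -phiC.
have [e eP] := boolp.choice ev.
apply: (@fg_submod_embed _ _ _ [seq e x | x <- s]) (fg_submod_noeth Rart Ef) _ _ => //.
move=> g _ eg; apply: HomP => x; rewrite [RHS]/=; have [c ->] := sP x.
have -> : \sum_(i < size s) phi (c i) * s`_i =
   \sum_(i < size s) c i *: (s`_i : restr phi (L^o : lmodType L)) by [].
rewrite linear_sum big1 // => i _; rewrite linearZ /=.
by rewrite -(eP s`_i g) eg ?scaler0 // map_f // mem_nth.
Qed.

End Base.

Lemma artin_submodule U V (j : Hom V U) : injective j -> fingen U -> fingen V.
Proof. by have [R [phi [Ra pC Lf]]] := Lart; exact: (submodule_fingen Ra Lf). Qed.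

Lemma artin_injective U : fingen U ->
  exists (E : lmodType L) (j : Hom U E), [/\ fingen E, injective_module E & injective j].
Proof.
have [R [phi [Ra pC Lf]]] := Lart => /(restr_fingen Lf) /(injective_hull Ra).
move=> [E [j [Ef Ei ji]]]; have [g gi] := coind_embed ji.
exists (coind phi E), g; split=> //; first exact: coind_fingen.
exact: coind_injective.
Qed.

Fixpoint Hom_pow U (f : Hom U U) (m : nat) : Hom U U :=
  if m is k.+1 then HomC (Hom_pow f k) f else Hom1 U.

(* For m large, F = f^(m+1) is bijective on its image, and [e] is the
   projection onto that image along the kernel of [F]. *)
Lemma fitting U (f : Hom U U) : fingen U ->
  exists m (e g : Hom U U), [/\ HomC e e = e, e = HomC g (Hom_pow f m.+1) &
    HomC (Hom_pow f m.+1) e = Hom_pow f m.+1 /\ HomC e (Hom_pow f m.+1) = Hom_pow f m.+1].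
Proof.
have [R [phi [Ra pC Lf]]] := Lart => Uf.
have /fingenP Uf' : fingen (restr phi U) by apply/(restr_fingen Lf).
have powE k x : Hom_pow f k.+1 x = f (Hom_pow f k x) by [].
have powE' k x : Hom_pow f k.+1 x = Hom_pow f k (f x).
  by elim: k x => [//|k IH] x; rewrite powE IH.
have powD k m x : Hom_pow f (k + m) x = Hom_pow f k (Hom_pow f m x).
  by elim: k => [//|k IH]; rewrite addSn powE IH.
have [k|k|k|N1 N1P] := fg_submod_dcc Ra Uf' (T := fun k => range (Hom_pow f k)).
- have [g gE] := restr_hom phi (Hom_pow f k).
  have -> : range (Hom_pow f k) = g @` [set: restr phi U].
    by apply/seteqP; split=> _ [x _ <-]; exists x; rewrite ?gE.
  by apply: image_submod; split.
- by [].
- by move=> _ [x _ <-]; rewrite powE'; exists (f x).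
have [k|k|k|N2 N2P] := @noeth_acc R (restr phi U) _ (fun k => [set x | Hom_pow f k x = 0])
    (fg_submod_noeth Ra Uf').
- split; first by rewrite /= linear0.
  move=> a x y /= kx ky; rewrite restr_scaleE.
  by rewrite -[LHS]/(Hom_pow f k (phi a *: (x : U) + y)) linearP kx ky scaler0 addr0.
- by [].
- by move=> x /= kx; rewrite /= kx linear0.
(* The exponent is positive since only positive powers of [f] will act on Ext as the given
   idempotent. *)
pose m := maxn N1 N2; exists m; set F := Hom_pow f m.+1.
have Fonto x : exists y, F (F y) = F x.
  have e : range (Hom_pow f (m.+1 + m.+1)) = range F.
    by rewrite (N1P (m.+1 + m.+1)%N) ?(N1P m.+1) //; lia.
  have : range F (F x) by exists x.
  by rewrite -e => -[y _ Fy]; exists y; rewrite -Fy powD.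
have Finj x : F (F x) = 0 -> F x = 0.
  have e : [set x | Hom_pow f (m.+1 + m.+1) x = 0] = [set x | F x = 0].
    by rewrite (N2P (m.+1 + m.+1)%N) ?(N2P m.+1) //; lia.
  by rewrite -powD => FFx; have : [set x | F x = 0] x by rewrite -e.
have [x|y [[z <-]]|a x x' y y' [[z <-] e] [[z' <-] e']|e eP] :=
    @Hom_of_relation _ U U (fun x y => (exists z, F z = y) /\ F x = F y).
- by have [y ey] := Fonto x; exists (F y); split; [exists y|].
- by rewrite linear0 => /esym /Finj.
- by split; [exists (a *: z + z'); rewrite linearP|rewrite !linearP e e'].
(* [g] is [e] followed by the inverse of [F] on its image; it exhibits [e] as a multiple of [F]. *)
have [x|y [[z <-]]|a x x' y y' [[z <-] h] [[z' <-] h']|g gP] :=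
    @Hom_of_relation _ U U (fun x y => (exists z, F z = y) /\ F y = e x).
- have [[z ez] _] := eP x; have [y ey] := Fonto z.
  by exists (F y); split; [exists y|rewrite ey].
- by rewrite linear0 => /Finj.
- by split; [exists (a *: z + z'); rewrite linearP|rewrite !linearP h h'].
have eF x : e (F x) = F x.
  have [[z ez] h] := eP (F x); apply/eqP; rewrite -subr_eq0 -ez -linearB; apply/eqP/Finj.
  by rewrite linearB linearB ez -h subrr.
exists e, g; split.
- by apply: HomP => x /=; have [[z <-] _] := eP x; rewrite eF.
- by apply: HomP => x /=; have [_] := gP x.
split; apply: HomP => x; first exact: eF.
by have [_] := eP x.
Qed.

End ArtinAlgebra.

(** * Syzygies and chains of short exact sequences *)

Section Homological.
Variable L : pzRingType.
Implicit Types U V W X Y Z N C I : lmodType L.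
Local Notation "f ;; g" := (HomC f g) (at level 40, left associativity).

Lemma HomCB U V W (f : Hom U V) (g h : Hom V W) : f ;; (g - h) = f ;; g - f ;; h.
Proof. exact: HomP. Qed.
Lemma HomBC U V W (f g : Hom U V) (h : Hom V W) : (f - g) ;; h = f ;; h - g ;; h.
Proof. by apply: HomP => x; rewrite /= linearB. Qed.

Lemma HomC_inj U V W (j : Hom V W) (f g : Hom U V) : injective j -> f ;; j = g ;; j -> f = g.
Proof.
move=> ji fg; apply: HomP => x; apply: ji.
by have /(congr1 (fun u : Hom _ _ => u x)) := fg.
Qed.

Lemma HomC_surj U V W (p : Hom U V) (f g : Hom V W) :
  (forall y, exists x, p x = y) -> p ;; f = p ;; g -> f = g.
Proof.
move=> ps fg; apply: HomP => y; have [x <-] := ps y.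
by have /(congr1 (fun u : Hom _ _ => u x)) := fg.
Qed.

Lemma coker_factor_comp Z N Y W (j : Hom Z N) (p : Hom N Y) (g : Hom N W) :
  short_exact j p -> j ;; g = 0 -> exists h : Hom Y W, p ;; h = g.
Proof.
case=> _ ps E jg; apply: coker_factor => // x /E[z <-].
by have /(congr1 (fun u : Hom _ _ => u z)) := jg.
Qed.

Lemma exact3_aug V : short_exact (Oincl V) (aug V).
Proof. by apply: exact3_ker; apply: aug_surj. Qed.

Lemma Free_lift_surj A N Y (p : Hom N Y) (h : Hom (Free A) Y) :
  (forall y, exists x, p x = y) -> exists h' : Hom (Free A) N, h' ;; p = h.
Proof.
move=> ps; have [f fP] := boolp.choice ps.
exists (free_lift (fun x : A => f (h (free_gen L x))) : {linear freemod L A -> N}).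
apply: free_ext => x.
by rewrite -[LHS]/(p (free_lift _ _)) free_lift_gen fP.
Qed.

(* The homs that are zero in [Ext^1 V X = Hom (Omega V) X / Hom (Free V) X]. *)
Definition ext1_zero V X (g : Hom (Omega V) X) : Prop := exists v, g = Oincl V ;; v.

Lemma ext1_zero0 V X : @ext1_zero V X 0. Proof. by exists 0; rewrite HomC0. Qed.
Lemma ext1_zeroB V X (f g : Hom (Omega V) X) : ext1_zero f -> ext1_zero g -> ext1_zero (f - g).
Proof. by move=> [u ->] [v ->]; exists (u - v); rewrite HomCB. Qed.
Lemma ext1_zeroN V X (f : Hom (Omega V) X) : ext1_zero f -> ext1_zero (- f).
Proof. by move=> fT; rewrite -(sub0r f); apply: ext1_zeroB => //; apply: ext1_zero0. Qed.
Lemma ext1_zeroD V X (f g : Hom (Omega V) X) : ext1_zero f -> ext1_zero g -> ext1_zero (f + g).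
Proof. by move=> fT gT; rewrite -(opprK g); apply: ext1_zeroB => //; apply: ext1_zeroN. Qed.
Lemma ext1_zero_trans V X (f g h : Hom (Omega V) X) :
  ext1_zero (f - g) -> ext1_zero (g - h) -> ext1_zero (f - h).
Proof. by move=> fg gh; rewrite -(subrK g f) -addrA; apply: ext1_zeroD. Qed.
Lemma ext1_zero_sub V X (f g : Hom (Omega V) X) : ext1_zero (f - g) -> ext1_zero g -> ext1_zero f.
Proof. by move=> fg gT; rewrite -(subrK g f); apply: ext1_zeroD. Qed.
Lemma ext1_zero_sym V X (f g : Hom (Omega V) X) : ext1_zero (f - g) -> ext1_zero (g - f).
Proof. by move=> fg; rewrite -opprB; apply: ext1_zeroN. Qed.
Lemma ext1_zero_post V X Y (f : Hom (Omega V) X) (g : Hom X Y) : ext1_zero f -> ext1_zero (f ;; g).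
Proof. by move=> [u ->]; exists (u ;; g); rewrite HomCA. Qed.
Lemma ext1_zero_pre V W X (f : Hom V W) (g : Hom (Omega W) X) :
  ext1_zero g -> ext1_zero (Omega_map f ;; g).
Proof. by move=> [u ->]; exists (Fmap f ;; u); rewrite !HomCA Oincl_nat. Qed.

(* [d] represents the class of the extension 0 -> Z -> N -> Y -> 0 in [Ext^1 Y Z]. *)
Definition connecting Z N Y (j : Hom Z N) (p : Hom N Y) (d : Hom (Omega Y) Z) : Prop :=
  exists s : Hom (Free Y) N, s ;; p = aug Y /\ d ;; j = Oincl Y ;; s.

Lemma conn_exists Z N Y (j : Hom Z N) (p : Hom N Y) : short_exact j p -> exists d, connecting j p d.
Proof.
move=> E; have [_ ps _] := E; have [s sE] := Free_lift_surj (aug Y) ps.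
have [|d dE] := ker_factor (g := Oincl Y ;; s) E; first by rewrite -HomCA sE aug_Oincl.
by exists d, s.
Qed.

(** [t] lands in the kernel [Z] of [p], and cancelling [j] extends [g] to [Free W]. This is the
    vanishing criterion in the calculations with connecting maps. *)
Lemma ext1_zero_lift Z N Y W (j : Hom Z N) (p : Hom N Y) (g : Hom (Omega W) Z)
    (t : Hom (Free W) N) :
  short_exact j p -> t ;; p = 0 -> g ;; j = Oincl W ;; t -> ext1_zero g.
Proof.
move=> E tp gj; have [t' t'E] := ker_factor E tp; exists t'.
by have [ji _ _] := E; apply: (HomC_inj ji); rewrite -HomCA t'E.
Qed.

(** * The long exact sequence in the second argument *)

Section Connecting.
Variables (Z N Y : lmodType L) (j : Hom Z N) (p : Hom N Y) (d : Hom (Omega Y) Z).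
Hypotheses (E : short_exact j p) (D : connecting j p d).

(** [Omega_map] respects differences only up to homotopy. The error of [Fmap], followed by [s], dies
    in [Y], so it is invisible in Ext^1. *)
Lemma push_sub W (u v : Hom W Y) :
  ext1_zero (Omega_map (u - v) ;; d - (Omega_map u ;; d - Omega_map v ;; d)).
Proof.
have [s [sp dj]] := D.
apply: (ext1_zero_lift (t := Fmap (u - v) ;; s - (Fmap u ;; s - Fmap v ;; s)) E).
  by rewrite !HomBC -!HomCA sp !aug_nat HomCB subrr.
by rewrite !HomBC !HomCB -!HomCA dj !HomCA !Oincl_nat.
Qed.

Lemma push_factor W (u : Hom W N) : ext1_zero (Omega_map (u ;; p) ;; d).
Proof.
have [s [sp dj]] := D.
apply: (ext1_zero_lift (t := Fmap (u ;; p) ;; s - aug W ;; u) E).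
  by rewrite !HomBC -!HomCA sp !aug_nat subrr.
by rewrite HomCB [Oincl W ;; (aug W ;; _)]HomCA aug_Oincl Hom0C subr0 -HomCA dj !HomCA Oincl_nat.
Qed.

(** A map that extends to [Free V] lifts there through [p] and so factors through [N]. With
    [push_sub] this makes the connecting map well defined on classes. *)
Lemma push_ext1_zero V (u : Hom (Omega V) Y) : ext1_zero u -> ext1_zero (Omega_map u ;; d).
Proof.
have [_ ps _] := E.
move=> [w ->]; have [w' <-] := Free_lift_surj w ps.
by rewrite HomCA; apply: push_factor.
Qed.

Lemma push_cong V (u v : Hom (Omega V) Y) :
  ext1_zero (u - v) -> ext1_zero (Omega_map u ;; d - Omega_map v ;; d).
Proof.
move=> uv; apply: ext1_zero_sub (push_ext1_zero uv).
exact/ext1_zero_sym/push_sub.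
Qed.

(** Exactness at Hom(W, Y): an extension [v] of the pushed map to [Free W] corrects [Fmap u ;; s] so
    that it descends to [W]. *)
Lemma push_inj W (u : Hom W Y) : ext1_zero (Omega_map u ;; d) -> exists u' : Hom W N, u' ;; p = u.
Proof.
have [s [sp dj]] := D; move=> [v dv].
have [|u' u'E] := @coker_factor_comp _ _ _ _ _ _ (Fmap u ;; s - v ;; j) (exact3_aug W).
  by rewrite HomCB !HomCA -dv -Oincl_nat -!HomCA dj subrr.
exists u'; apply: (HomC_surj (@aug_surj _ _)).
by rewrite HomCA u'E HomBC -!HomCA sp aug_nat (exact3_comp0 E) HomC0 subr0.
Qed.

(** A lift of [u] to [N] extends to [Free V] by injectivity. This is the dimension shift from
    Ext^2(V, Z) to Ext^1(V, Y). *)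
Lemma push_inj_ext1_zero V (u : Hom (Omega V) Y) : injective_module N ->
  ext1_zero (Omega_map u ;; d) -> ext1_zero u.
Proof.
move=> Ni /push_inj[u' <-]; have [ji _ _] := exact3_aug V.
by have [h <-] := Ni _ _ _ u' ji; apply: ext1_zero_post; exists h.
Qed.

(** Exactness at Ext^1(W, Z): the extension of [eta ;; j] to [Free W], followed by [p], kills
    [Omega W] and descends to [u]. *)
Lemma connecting_exact W (eta : Hom (Omega W) Z) : ext1_zero (eta ;; j) ->
  exists u : Hom W Y, ext1_zero (eta - Omega_map u ;; d).
Proof.
have [s [sp dj]] := D; move=> [h eh].
have [|u uE] := @coker_factor_comp _ _ _ _ _ _ (h ;; p) (exact3_aug W).
  by rewrite HomCA -eh -HomCA (exact3_comp0 E) HomC0.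
exists u; apply: (ext1_zero_lift (t := h - Fmap u ;; s) E).
  by rewrite HomBC -uE -!HomCA sp aug_nat subrr.
by rewrite HomBC HomCB eh -HomCA dj !HomCA Oincl_nat.
Qed.

(** The right-hand square induces the map [h] of kernels, and connecting maps are natural for it. *)
Lemma square Z' N' Y' (j' : Hom Z' N') (p' : Hom N' Y') (d' : Hom (Omega Y') Z')
    (x : Hom Y Y') (l : Hom N N') :
  short_exact j' p' -> connecting j' p' d' -> p ;; x = l ;; p' ->
  exists h : Hom Z Z', j ;; l = h ;; j' /\ ext1_zero (Omega_map x ;; d' - d ;; h).
Proof.
move=> E' [s' [sp' dj']] pl; have [s [sp dj]] := D.
have [|h hE] := ker_factor (g := j ;; l) E'.
  by rewrite -HomCA -pl HomCA (exact3_comp0 E) Hom0C.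
exists h; split=> //; apply: (ext1_zero_lift (t := Fmap x ;; s' - s ;; l) E').
  by rewrite HomBC -!HomCA sp' -pl aug_nat [s ;; _]HomCA sp subrr.
by rewrite HomBC HomCB -!HomCA dj' hE !HomCA Oincl_nat dj.
Qed.

End Connecting.

(* Vanishing of [Ext^(k+1) Y X]. *)
Definition ext_acyclic k Y X : Prop := forall g : Hom (syz k.+1 Y) X, @ext1_zero (syz k Y) X g.

Lemma injective_acyclic k Y I : injective_module I -> ext_acyclic k Y I.
Proof.
move=> Ii g; have [ji _ _] := exact3_aug (syz k Y).
by have [h hE] := Ii _ _ _ g ji; exists h.
Qed.

Lemma ext_acyclic_shift k N X I C (i : Hom X I) (q : Hom I C) : short_exact i q ->
  injective_module I -> ext_acyclic k.+1 N X -> ext_acyclic k N C.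
Proof.
move=> E Ii NX g; have [d D] := conn_exists E.
by apply: (push_inj_ext1_zero E D Ii); apply: NX.
Qed.

Lemma ext_acyclic_retract k Y X B (i : Hom B X) (r : Hom X B) : i ;; r = Hom1 B ->
  ext_acyclic k Y X -> ext_acyclic k Y B.
Proof. by move=> ir YX g; rewrite -(HomCf1 g) -ir HomCA; apply/ext1_zero_post/YX. Qed.

Lemma embed_exact X : exists I C (i : Hom X I) (q : Hom I C) d,
  [/\ short_exact i q, connecting i q d & injective_module I].
Proof.
have [I [i [Ii ii]]] := embed_injective X; have [C [q E]] := exact3_coker ii.
by have [d D] := conn_exists E; exists I, C, i, q, d.
Qed.

(** A segment of the long exact sequence in the first argument, where for [k = 0] the term of [Z] is
    Hom modulo maps that extend to [N]. Induction replaces [X] by its cokernel in an injective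
    module. *)
Lemma ext_acyclic_cokernel k Z N Y X (j : Hom Z N) (p : Hom N Y) :
  short_exact j p -> ext_acyclic k N X ->
  (if k is k'.+1 then ext_acyclic k' Z X else forall g : Hom Z X, exists g', j ;; g' = g) ->
  ext_acyclic k Y X.
Proof.
move=> E; have [ji ps _] := E; have [dN DN] := conn_exists E.
elim: k X => [|k IH] X NX ZX g; have [I [C [i [q [d [Eq D Ii]]]]]] := embed_exact X.
  have [|u gu] := connecting_exact Eq D (eta := g); first exact: (@injective_acyclic 0 Y I Ii (g ;; i)).
  apply: ext1_zero_sub gu _.
  (* [u] lifts to [I] after pulling back to [N], and the lift induces [h] on [Z]. Subtracting an
     extension of [h] to [N] makes the lift descend to [Y]. *)
  have [|l lE] := push_inj Eq D (u := p ;; u); first exact: NX.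
  have [|h [hE _]] := square E DN Eq D (x := u) (l := l); first by rewrite lE.
  have [h' h'E] := ZX h.
  have [|v vE] := coker_factor_comp (g := l - h' ;; i) E.
    by rewrite HomCB HomCA h'E hE subrr.
  suff <- : v ;; q = u by exact: (push_factor Eq D).
  apply: (HomC_surj ps); rewrite HomCA vE HomBC lE -HomCA (exact3_comp0 Eq).
  by rewrite HomC0 subr0.
have [|u gu] := connecting_exact Eq D (eta := g); first exact: (@injective_acyclic k.+1 Y I Ii (g ;; i)).
apply: ext1_zero_sub gu _; apply: (push_ext1_zero Eq D); apply: IH.
  exact: (ext_acyclic_shift Eq Ii NX).
(* At the last shift, vanishing of Ext^1(Z, X) must become an extension property: a map to [C] lifts
   to [I] and then extends along [j]. *)
case: k ZX {NX u g} => [|k] ZX; last exact: (ext_acyclic_shift Eq Ii ZX).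
move=> g; have [|g1 <-] := push_inj Eq D (u := g); first exact: ZX.
by have [g2 <-] := Ii _ _ _ g1 ji; exists (g2 ;; q); rewrite HomCA.
Qed.

Definition projective V : Prop := exists s : Hom V (Free V), s ;; aug V = Hom1 V.

Lemma projective_retract V : projective V ->
  exists r : Hom (Free V) (Omega V), Oincl V ;; r = Hom1 (Omega V).
Proof.
move=> [s sE]; have [|r rE] := ker_factor (g := Hom1 (Free V) - aug V ;; s) (exact3_aug V).
  by rewrite HomBC HomC1f -HomCA sE HomCf1 subrr.
exists r; apply: Oincl_inj.
by rewrite -HomCA rE HomCB HomCf1 HomCA aug_Oincl Hom0C subr0 HomC1f.
Qed.

Lemma projective_Omega V : projective V -> projective (Omega V).
Proof.
move=> /projective_retract[r rE]; have [r' r'E] := Free_lift r.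
by exists (Oincl V ;; r'); rewrite -HomCA r'E.
Qed.

Lemma projective_acyclic k V X : projective V -> ext_acyclic k V X.
Proof.
move=> Vp; have {Vp} : projective (syz k V).
  by elim: k => [//|k IH]; apply: projective_Omega.
move=> /projective_retract[r rE] g; exists (r ;; g).
by rewrite HomCA rE HomC1f.
Qed.

(** The free module on the index set of the generators is used instead of [Free U], which need not
    be finitely generated. *)
Lemma fingen_cover U : fingen U ->
  exists P (p : Hom P U), [/\ fingen P, projective P & forall y, exists x, p x = y].
Proof.
move=> [s sP]; pose P : lmodType L := freemod L 'I_(size s).
pose p : Hom P U := free_lift (fun i : 'I_(size s) => s`_i) : {linear _ -> _}.
exists P, p; split.
- pose gs := [seq free_gen L i | i <- enum 'I_(size s)] : seq P.
  have gsz : size gs = size s by rewrite size_map size_enum_ord.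
  have [a x y|f fE] := @Hom_of_linear L P P (fun x => \sum_i (free_val x i : L) *: free_gen L i).
    rewrite scaler_sumr -big_split /=; apply: eq_bigr => i _.
    by rewrite scalerA -scalerDl.
  have fid : f = Hom1 P.
    apply: (@free_ext L 'I_(size s) P) => i; rewrite fE (bigD1 i) //= eqxx scale1r.
    by rewrite big1 ?addr0 // => k /negPf ki; rewrite ki scale0r.
  apply/fingenP; exists gs; apply/seteqP; split=> // x _.
  have -> : x = f x by rewrite fid.
  rewrite fE; elim/big_ind: _ => [|u v|i _]; first exact: submod0 (span_submod gs).
    exact: submodD (span_submod gs).
  by apply: submodZ (span_submod gs) _; apply: span_mem; apply: map_f; rewrite mem_enum.
- exists (free_lift (fun i : 'I_(size s) => free_gen L (free_gen L i : P))
           : {linear freemod L 'I_(size s) -> freemod L P}).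
  apply: (@free_ext L 'I_(size s) P) => i.
  by rewrite -[LHS]/(aug P (free_lift _ _)) free_lift_gen augE.
- move=> y; have [c ->] := sP y; exists (\sum_i c i *: free_gen L i).
  rewrite linear_sum; apply: eq_bigr => i _; rewrite linearZ.
  by rewrite -[X in _ *: X](free_lift_gen (fun i : 'I_(size s) => s`_i)).
Qed.

(* Index [n] means [n + 1] short exact sequences; [k] represents their Yoneda
   class in [Ext^(n+1) Z0 Zn]. *)
Inductive chain (Q : lmodType L -> Prop) Z0 N0 (p0 : Hom N0 Z0) :
  forall n Zn, Hom (syz n.+1 Z0) Zn -> Prop :=
| chain_one Z1 (j : Hom Z1 N0) (d : Hom (Omega Z0) Z1) :
    Q N0 -> short_exact j p0 -> connecting j p0 d -> @chain Q Z0 N0 p0 0 Z1 d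
| chain_snoc n Zn (k : Hom (syz n.+1 Z0) Zn) N Z' (j : Hom Z' N) (p : Hom N Zn) d :
    chain Q p0 k -> Q N -> short_exact j p -> connecting j p d ->
    @chain Q Z0 N0 p0 n.+1 Z' (Omega_map k ;; d).

Section Chain.
Variables (Q : lmodType L -> Prop) (Z0 N0 : lmodType L) (p0 : Hom N0 Z0).

(** Pulling back along [p0] splits the first sequence, and the later connecting maps preserve zero
    classes. *)
Lemma chain_first n Zn (k : Hom (syz n.+1 Z0) Zn) : chain Q p0 k ->
  @ext1_zero (syz n N0) Zn (syz_map n.+1 p0 ;; k).
Proof.
elim=> [Z1 j d _ E D|{}n {}Zn {}k N Z' j p d _ IH _ E D].
  by rewrite -(HomC1f p0); apply: (push_factor E D).
by rewrite HomCA -Omega_mapM; apply: (push_ext1_zero E D).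
Qed.

(** The class is lowered one sequence at a time: it dies in the middle term by acyclicity, hence
    comes from the end term before it. *)
Lemma cov_chain n Zn (k : Hom (syz n.+1 Z0) Zn) Y : chain Q p0 k ->
  (forall i N, (i <= n)%N -> Q N -> ext_acyclic i Y N) ->
  forall eta : Hom (syz n.+1 Y) Zn,
    exists f : Hom Y Z0, @ext1_zero (syz n Y) Zn (eta - syz_map n.+1 f ;; k).
Proof.
elim=> [Z1 j d QN E D|{}n {}Zn {}k N Z' j p d _ IH QN E D] YQ eta.
  by apply: (connecting_exact E D); apply: (YQ 0%N).
have [|u eu] := connecting_exact E D (eta := eta); first exact: (YQ n.+1).
have [|f fE] := IH _ u; first by move=> i N' ni; apply: YQ; apply: leqW.
exists f; apply: ext1_zero_trans eu _.
by rewrite HomCA -Omega_mapM; apply: (push_cong E D).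
Qed.

(** Only the last sequence involves the top degree. There acyclicity is replaced by the hypothesis
    that the given class dies in the middle term [N]. *)
Lemma chain_last n Zn (k : Hom (syz n.+1 Z0) Zn) : chain Q p0 k ->
  exists N (j : Hom Zn N), [/\ Q N, @ext1_zero (syz n Z0) N (k ;; j) &
    forall Y, (forall i N', (i < n)%N -> Q N' -> ext_acyclic i Y N') ->
      forall eta : Hom (syz n.+1 Y) Zn, @ext1_zero (syz n Y) N (eta ;; j) ->
      exists f : Hom Y Z0, @ext1_zero (syz n Y) Zn (eta - syz_map n.+1 f ;; k)].
Proof.
case=> [Z1 j d QN E D|{}n {}Zn {}k N Z' j p d ch QN E D].
  exists N0, j; split=> //; first by have [s [_ ->]] := D; exists s.
  by move=> Y _ eta; apply: (connecting_exact E D).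
exists N, j; split=> //.
  by have [s [_ e]] := D; rewrite -HomCA e; apply: ext1_zero_pre; exists s.
move=> Y YQ eta /(connecting_exact E D)[u eu].
have [f fE] := cov_chain ch YQ u.
exists f; apply: ext1_zero_trans eu _.
by rewrite HomCA -Omega_mapM; apply: (push_cong E D).
Qed.

(* Along X -> I -> C with I injective, a class in Ext^(n+2)(Z0,X) comes from one in
   Ext^(n+1)(Z0,C), to which the induction hypothesis applies. *)
Lemma contra_chain n Zn (k : Hom (syz n.+1 Z0) Zn) : chain Q p0 k ->
  forall X, (forall i N, (i < n)%N -> Q N -> ext_acyclic i N X) ->
  forall x : Hom (syz n.+1 Z0) X, @ext1_zero (syz n N0) X (syz_map n.+1 p0 ;; x) ->
    exists h : Hom Zn X, @ext1_zero (syz n Z0) X (x - k ;; h).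
Proof.
elim=> [Z1 j d QN E D|{}n {}Zn {}k N Z' j p d _ IH QN E D] X XQ x px;
  have [I [C [i [q [dX [Eq DX Ii]]]]]] := embed_exact X.
  have [|x' xx'] := connecting_exact Eq DX (eta := x);
    first exact: (@injective_acyclic 0 Z0 I Ii (x ;; i)).
  have [|l lE] := push_inj Eq DX (u := p0 ;; x').
    apply: ext1_zero_sub px; rewrite Omega_mapM -HomCA -HomCB; apply: ext1_zero_pre.
    exact: ext1_zero_sym.
  have [|h [_ hE]] := square E D Eq DX (x := x') (l := l); first by rewrite lE.
  by exists h; apply: ext1_zero_trans xx' hE.
have [|x' xx'] := connecting_exact Eq DX (eta := x);
  first exact: (@injective_acyclic n.+1 Z0 I Ii (x ;; i)).
have [||h' h'E] := IH C _ x'.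
- by move=> i' N' i'n QN'; apply: (ext_acyclic_shift Eq Ii); apply: XQ.
- apply: (push_inj_ext1_zero Eq DX Ii); apply: ext1_zero_sub px.
  by rewrite Omega_mapM -HomCA -HomCB; apply: ext1_zero_pre; apply: ext1_zero_sym.
(* [h'] is a map to [C]. As Ext^1(N, X) = 0, its pullback to [N] lifts to [I], and the map induced
   on kernels is the required [h]. *)
have [|l lE] := push_inj Eq DX (u := p ;; h'); first exact: (XQ 0%N).
have [|h [_ hE]] := square E D Eq DX (x := h') (l := l); first by rewrite lE.
exists h; apply: ext1_zero_trans xx' _; apply: ext1_zero_trans (push_cong Eq DX h'E) _.
by rewrite Omega_mapM -!HomCA -HomCB; apply: ext1_zero_pre.
Qed.

End Chain.

(** * Ext classes as maps out of syzygies *)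

Section ExtClass.
Variables (n : nat) (A B : lmodType L).

Lemma ecl_subproof (g : Hom (syz n A) B) : aug (syz n A) ;; g \in @cocycle L n A B.
Proof. by apply/eqP; rewrite /res_d HomCA -(HomCA (aug _)) aug_Oincl HomC0 Hom0C. Qed.

(** A cocycle kills the image of the next differential, so it factors through [aug] as a map out of
    the syzygy. In positive degree coboundaries become the maps in [ext1_zero]. *)
Definition ext_class_of (g : Hom (syz n A) B) : Ext n A B := Ext_class (Cocycle (ecl_subproof g)).

Lemma ecl_surj (x : Ext n A B) : exists g, x = ext_class_of g.
Proof.
elim/Ext_ind: x => -[u uP]; have /eqP uE := uP.
have [|g gE] := coker_factor_comp (g := u) (exact3_aug (syz n A)).
  apply: (HomC_surj (@aug_surj _ _)); rewrite HomC0 HomCA; exact: uE.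
by exists g; congr Ext_class; apply: val_inj; rewrite /= gE.
Qed.

End ExtClass.

Lemma eclE n A B (g h : Hom (syz n.+1 A) B) :
  ext_class_of g = ext_class_of h <-> @ext1_zero (syz n A) B (g - h).
Proof.
rewrite /ext_class_of Ext_classP /= -HomCB; split=> -[v vE]; exists v.
  by apply: (HomC_surj (@aug_surj _ _)); rewrite vE /res_d HomCA.
by rewrite vE HomCA.
Qed.

Lemma ecl_0 n A B : @ext_class_of n A B 0 = 0.
Proof.
pose z := ext_class_of (0 : Hom (syz n A) B); have e : z + z = z.
  rewrite /z /ext_class_of -Ext_classD; congr Ext_class; apply: val_inj.
  by rewrite [LHS](raddfD val) /= !HomC0 addr0.
by apply: (@addrI _ z); rewrite e addr0.
Qed.

Lemma ecl_eq0 n A B (g : Hom (syz n.+1 A) B) : ext_class_of g = 0 <-> @ext1_zero (syz n A) B g.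
Proof. by rewrite -(ecl_0 n.+1 A B) eclE subr0. Qed.

Lemma Ext_map_ecl n A A' B B' (f : Hom A' A) (h : Hom B B') (g : Hom (syz n A) B) :
  Ext_map n f h (ext_class_of g) = ext_class_of (syz_map n f ;; g ;; h).
Proof.
rewrite /= Ext_map_funE; congr Ext_class; apply: val_inj => /=.
by rewrite /res_map !HomCA aug_nat.
Qed.

Lemma Ext_vanish_acyclic k A B : (forall x : Ext k.+1 A B, x = 0) <-> ext_acyclic k A B.
Proof.
split=> [H g|H x]; first by apply/ecl_eq0; apply: H.
by have [g ->] := ecl_surj x; apply/ecl_eq0; apply: H.
Qed.

End Homological.

(** * Cluster tilting subcategories *)

(** The idempotent is the projection onto the summand. Two splittings of one idempotent are
    isomorphic, so [F] can be recognised by splitting [pi] in another way. *)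
Lemma summand_idempotent (C : preadditive) (F G : functor C) : direct_summand F G ->
  exists pi : nattrans G G, (forall X x, pi X (pi X x) = pi X x) /\
    forall (H : functor C) (a : nattrans G H) (b : nattrans H G),
      (forall X y, a X (b X y) = y) -> (forall X x, b X (a X x) = pi X x) ->
      funct_iso F H.
Proof.
move=> [F' [s [t st]]]; have sK X : cancel (s X) (t X) by case: (st X).
have pD X : zmod_morphism (fun x : G X => s X ((t X x).1, 0)).
  move=> x y; rewrite -!raddfB; congr (s X _).
  by rewrite raddfB -[RHS]/(_, 0 - 0) subr0.
pose p X : {additive G X -> G X} :=
  HB.pack (fun x : G X => s X ((t X x).1, 0)) (GRing.isZmodMorphism.Build _ _ _ (pD X)).
have pn (X Y : C) (h : hom X Y) x : p Y (fmap G h x) = fmap G h (p X x).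
  rewrite -[RHS]/(fmap G h (s X ((t X x).1, 0))) -(nnat s).
  rewrite -[LHS]/(s Y ((t Y (fmap G h x)).1, 0)) (nnat t).
  by rewrite -[RHS]/(s Y (fmap F h (t X x).1, fmap F' h 0)) raddf0.
exists (NatTrans pn); split=> [X x|H a b ab ba] /=; first by rewrite sK.
have add0 X : zmod_morphism (fun z : F X => a X (s X (z, 0))).
  move=> x y; rewrite -!raddfB; congr (a X (s X _)).
  by rewrite -[RHS]/(x - y, 0 - 0) subr0.
have add1 X : zmod_morphism (fun y : H X => (t X (b X y)).1).
  by move=> x y; rewrite !raddfB.
pose f X : {additive F X -> H X} :=
  HB.pack (fun z : F X => a X (s X (z, 0))) (GRing.isZmodMorphism.Build _ _ _ (add0 X)).
pose g X : {additive H X -> F X} :=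
  HB.pack (fun y : H X => (t X (b X y)).1) (GRing.isZmodMorphism.Build _ _ _ (add1 X)).
have fn (X Y : C) (h : hom X Y) x : f Y (fmap F h x) = fmap H h (f X x).
  rewrite -[RHS]/(fmap H h (a X (s X (x, 0)))) -(nnat a) -(nnat s).
  by rewrite -[RHS]/(a Y (s Y (fmap F h x, fmap F' h 0))) raddf0.
have gn (X Y : C) (h : hom X Y) x : g Y (fmap H h x) = fmap F h (g X x).
  by rewrite -[LHS]/((t Y (b Y (fmap H h x))).1) (nnat b) (nnat t).
exists (NatTrans fn), (NatTrans gn) => X; split=> [x|y] /=.
  by rewrite ba /= !sK.
by have /= <- := ba X (b X y); rewrite !ab.
Qed.

Section ClusterTilting.
Variables (L : pzRingType) (n : nat) (M : modfg L -> Prop).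
Hypotheses (Lart : artin_algebra L) (CT : cluster_tilting n M).
Local Notation "f ;; g" := (HomC f g) (at level 40, left associativity).
Implicit Types A B U V X Y Z N : lmodType L.

(** [M] speaks of modules packed with a proof of finite generation; this form applies to bare
    kernels and cokernels. *)
Definition in_M X : Prop := exists Xf : fingen X, M (exist _ X Xf).

Lemma in_M_sval (X : modfg L) : M X -> in_M (sval X).
Proof. by case: X => X Xf MX; exists Xf. Qed.

Lemma in_M_acyclic i X Y : in_M X -> in_M Y -> (i.+1 < n)%N -> ext_acyclic i X Y.
Proof.
move=> [Xf MX] [Yf MY] i_n; have [_ _ _ H _] := CT.
apply/Ext_vanish_acyclic.
by have := (H (exist _ Y Yf)).1 MY (exist _ X Xf) i.+1 MX; apply.
Qed.

Lemma in_M_of_acyclicR X : fingen X ->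
  (forall N i, in_M N -> (i.+1 < n)%N -> ext_acyclic i N X) -> in_M X.
Proof.
move=> Xf XM; exists Xf; have [_ _ _ H _] := CT; apply/H => N [//|i] MN /andP[_ i_n].
by apply/Ext_vanish_acyclic; apply: XM => //; apply: in_M_sval.
Qed.

Lemma in_M_of_acyclicL X : fingen X ->
  (forall N i, in_M N -> (i.+1 < n)%N -> ext_acyclic i X N) -> in_M X.
Proof.
move=> Xf XM; exists Xf; have [_ _ _ _ H] := CT; apply/H => N [//|i] MN /andP[_ i_n].
by apply/Ext_vanish_acyclic; apply: XM => //; apply: in_M_sval.
Qed.

(** A surjection from an object of [M] factors through the right approximation, which is therefore
    surjective. *)
Lemma right_approx_epi X : fingen X -> exists N (p : Hom N X),
  [/\ in_M N, forall y, exists x, p x = y &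
      forall N' (g : Hom N' X), in_M N' -> exists h, g = h ;; p].
Proof.
move=> Xf; have [_ ff [gen _] _ _] := CT; pose X' : modfg L := exist _ X Xf.
have [[N [p [MN pP]]] _] := ff X'.
have pP' N' (g : Hom N' X) : in_M N' -> exists h, g = h ;; p.
  by move=> [N'f MN']; have [h hE] := pP (exist _ N' N'f) g MN'; exists h.
exists (sval N), p; split=> //; first exact: in_M_sval.
move=> y; have [G [g [MG gs]]] := gen X'.
have [h hE] := pP' _ g (in_M_sval MG); have [x xy] := gs y.
by exists (h x); rewrite -xy hE.
Qed.

Lemma left_approx_mono X : fingen X -> exists N (j : Hom X N),
  [/\ in_M N, injective j &
      forall N' (g : Hom X N'), in_M N' -> exists h, g = j ;; h].
Proof.
move=> Xf; have [_ ff [_ cogen] _ _] := CT; pose X' : modfg L := exist _ X Xf.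
have [_ [N [p [MN pP]]]] := ff X'.
have pP' N' (g : Hom X N') : in_M N' -> exists h, g = p ;; h.
  by move=> [N'f MN']; have [h hE] := pP (exist _ N' N'f) g MN'; exists h.
exists (sval N), p; split=> //; first exact: in_M_sval.
have [G [g [MG gi]]] := cogen X'; have [h hE] := pP' _ g (in_M_sval MG).
by move=> x y pxy; apply: gi; rewrite hE /= pxy.
Qed.

Lemma in_M_fingen X : in_M X -> fingen X. Proof. by case. Qed.

Lemma projective_in_M X : fingen X -> projective X -> in_M X.
Proof. by move=> Xf Xp; apply: in_M_of_acyclicL => // N i _ _; apply: projective_acyclic. Qed.

Lemma injective_in_M X : fingen X -> injective_module X -> in_M X.
Proof. by move=> Xf Xi; apply: in_M_of_acyclicR => // N i _ _; apply: injective_acyclic. Qed.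

Lemma in_M_retract X B (i : Hom B X) (r : Hom X B) : i ;; r = Hom1 B ->
  fingen B -> in_M X -> in_M B.
Proof.
move=> ir Bf MX; apply: in_M_of_acyclicR => // N k MN kn.
exact: ext_acyclic_retract ir (in_M_acyclic MN MX kn).
Qed.

(** After the first sequence each step takes the kernel of a right approximation. Lifting through it
    kills Ext^1 from [M], and the vanishing already known moves up one degree. *)
Lemma cov_chain_exists Z0 N0 (p0 : Hom N0 Z0) k : fingen Z0 -> in_M N0 ->
  (forall y, exists x, p0 x = y) -> (k < n)%N ->
  exists Z (c : Hom (syz k.+1 Z0) Z), [/\ chain in_M p0 c, fingen Z &
    forall Y i, in_M Y -> (i < k)%N -> ext_acyclic i Y Z].
Proof.
move=> Zf MN0 ps; elim: k => [|k IH] kn.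
  have E := exact3_ker ps; have [d D] := conn_exists E.
  exists (kermod p0), d; split=> //; first exact: chain_one E D.
  by have [ji _ _] := E; exact: artin_submodule ji (in_M_fingen MN0).
have [Z [c [ch {}Zf ZM]]] := IH (ltnW kn).
have [N [p [MN {}ps pP]]] := right_approx_epi Zf.
have E := exact3_ker ps; have [d D] := conn_exists E.
exists (kermod p), (Omega_map c ;; d); split; first exact: chain_snoc ch MN E D.
  by have [ji _ _] := E; exact: artin_submodule ji (in_M_fingen MN).
move=> Y i MY ik g; have [|u gu] := connecting_exact E D (eta := g).
  by apply: (in_M_acyclic MY MN); apply: leq_trans kn.
apply: ext1_zero_sub gu _; case: i ik u {g} => [|i] ik u.
  by have [h ->] := pP _ u MY; apply: (push_factor E D).
by apply: (push_ext1_zero E D); apply: ZM.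
Qed.

(** The cokernel of a left approximation gains one degree of vanishing: maps from [V] to [M] extend
    to [N], which settles Ext^1, and the other degrees shift. *)
Lemma contra_step k V : fingen V -> (k.+1 < n)%N ->
  (forall Y i, in_M Y -> (i < k)%N -> ext_acyclic i V Y) ->
  exists N C (j : Hom V N) (p : Hom N C) d, [/\ in_M N, short_exact j p, connecting j p d, fingen C &
    forall Y i, in_M Y -> (i < k.+1)%N -> ext_acyclic i C Y].
Proof.
move=> Vf kn VM; have [N [j [MN ji jP]]] := left_approx_mono Vf.
have [C [p E]] := exact3_coker ji; have [d D] := conn_exists E; have [_ ps _] := E.
exists N, C, j, p, d; split=> //; first exact: (fingen_epi ps (in_M_fingen MN)).
move=> Y i MY ik; apply: (ext_acyclic_cokernel E); first by apply: (in_M_acyclic MN MY); lia.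
case: i ik => [_ g|i ik]; last by apply: VM.
by have [g' ->] := jP _ g MY; exists g'.
Qed.

(** The recursion passes from [V] to its cokernel and attaches the sequence at [V] last; [k] counts
    the degrees of vanishing already gained. *)
Lemma contra_chain_exists k m V : fingen V -> (k + m.+1 < n)%N ->
  (forall Y i, in_M Y -> (i < k)%N -> ext_acyclic i V Y) ->
  exists Z0 N0 (p0 : Hom N0 Z0) (c : Hom (syz m.+1 Z0) V),
    [/\ chain in_M p0 c, fingen Z0 & forall Y i, in_M Y -> (i < k + m.+1)%N -> ext_acyclic i Z0 Y].
Proof.
elim: m k V => [|m IH] k V Vf kn VM;
  (have [|N [C [j [p [d [MN E D Cf CM]]]]]] := contra_step Vf _ VM; first by lia).
  exists C, N, p, d; split=> //; first exact: chain_one MN E D.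
  by move=> Y i MY ik; apply: CM => //; lia.
have [|Z0 [N0 [p0 [c [ch Zf ZM]]]]] := IH k.+1 C Cf _ CM; first by lia.
exists Z0, N0, p0, (Omega_map c ;; d); split=> //; first exact: chain_snoc ch MN E D.
by move=> Y i MY ik; apply: ZM => //; lia.
Qed.

(** [Z] ends a chain of [n] sequences, and the vanishing obtained puts it in [M]. The pullback
    criterion is [chain_last]; the projective first term makes [contra_chain] apply to every
    class. *)
Lemma universal_cov m A : n = m.+1 -> in_M A ->
  exists Z (xi : Ext m.+1 A Z) N (iota : Hom Z N),
  [/\ in_M Z, in_M N, Ext_map m.+1 (Hom1 A) iota xi = 0,
    (forall eta : Ext m.+1 A Z, Ext_map m.+1 (Hom1 A) iota eta = 0 ->
       exists f : Hom A A, eta = Ext_map m.+1 f (Hom1 Z) xi)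
  & forall X (x : Ext m.+1 A X), in_M X -> exists h : Hom Z X, x = Ext_map m.+1 (Hom1 A) h xi].
Proof.
move=> nm MA; have Af := in_M_fingen MA.
have [P [p0 [Pf Pp ps]]] := fingen_cover Af.
have [|Z [c [ch Zf ZM]]] := cov_chain_exists Af (projective_in_M Pf Pp) ps (k := m).
  by rewrite nm.
have MZ : in_M Z by apply: in_M_of_acyclicR => // N i MN; rewrite nm => im; apply: ZM.
have [N [iota [MN ci last]]] := chain_last ch.
exists Z, (ext_class_of c), N, iota; split=> //.
- by rewrite Ext_map_ecl syz_map1 HomC1f; apply/ecl_eq0.
- move=> eta; have [g ->] := ecl_surj eta.
  rewrite Ext_map_ecl syz_map1 HomC1f => /ecl_eq0 gi.
  have [i N' im MN'|f fE] := last A _ g gi; first by apply: in_M_acyclic => //; rewrite nm.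
  by exists f; rewrite Ext_map_ecl HomCf1; apply/eclE.
move=> X x MX; have [g ->] := ecl_surj x.
have [i N' im MN'||h hE] := contra_chain ch (X := X) _ (x := g).
- by apply: in_M_acyclic => //; rewrite nm.
- exact: projective_acyclic.
by exists h; rewrite Ext_map_ecl syz_map1 HomC1f; apply/eclE.
Qed.

(** The roles are exchanged: [contra_chain] gives the criterion, and the chain has an injective term
    next to [A] so that every class is a pullback of [xi]. *)
Lemma universal_contra m A : n = m.+1 -> in_M A ->
  exists Z (xi : Ext m.+1 Z A) N (p : Hom N Z),
  [/\ in_M Z, in_M N, Ext_map m.+1 p (Hom1 A) xi = 0,
    (forall eta : Ext m.+1 Z A, Ext_map m.+1 p (Hom1 A) eta = 0 ->
       exists f : Hom A A, eta = Ext_map m.+1 (Hom1 Z) f xi)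
  & forall Y (y : Ext m.+1 Y A), in_M Y -> exists h : Hom Y Z, y = Ext_map m.+1 h (Hom1 A) xi].
Proof.
move=> nm MA; have Af := in_M_fingen MA.
have [I [j [If Ii ji]]] := artin_injective Lart Af.
have MI := injective_in_M If Ii.
have [C [q E]] := exact3_coker ji; have [d D] := conn_exists E; have [_ qs _] := E.
have Cf := fingen_epi qs If.
have [Z [N [p [c [ch Zf MN ZM cov]]]]] : exists Z N (p : Hom N Z) (c : Hom (syz m.+1 Z) A),
    [/\ chain in_M p c, fingen Z, in_M N, forall Y i, in_M Y -> (i < m)%N -> ext_acyclic i Z Y &
      forall Y (eta : Hom (syz m.+1 Y) A), in_M Y ->
        exists f : Hom Y Z, @ext1_zero _ (syz m Y) A (eta - syz_map m.+1 f ;; c)].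
  case: m nm => [|m] nm.
    (* For [n = 1] the single sequence starting at [A] suffices, the range of vanishing degrees
       being empty. *)
    exists C, I, q, d; split=> //; first exact: chain_one MI E D.
    by move=> Y eta _; apply: (connecting_exact E D); apply: (@injective_acyclic _ 0 Y I Ii).
  have [||Z [N [p [c [ch Zf ZM]]]]] := @contra_chain_exists 0 m C Cf.
  - by rewrite nm.
  - by [].
  exists Z, N, p, (Omega_map c ;; d); split=> //; first exact: chain_snoc ch MI E D.
    by elim: ch.
  (* In degree [n] the vanishing comes from injectivity of [I]; the other middle terms are met only
     in degrees below [n]. *)
  move=> Y eta MY; have [|u uE] := connecting_exact E D (eta := eta).
    exact: (@injective_acyclic _ m.+1 Y I Ii).
  have [i N' im MN'|f fE] := cov_chain ch (Y := Y) _ u.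
    by apply: in_M_acyclic => //; rewrite nm !ltnS.
  exists f; apply: ext1_zero_trans uE _.
  by rewrite HomCA -Omega_mapM; apply: (push_cong E D).
have MZ : in_M Z by apply: in_M_of_acyclicL => // X i MX; rewrite nm => im; apply: ZM.
exists Z, (ext_class_of c), N, p; split=> //.
- by rewrite Ext_map_ecl HomCf1; apply/ecl_eq0; apply: chain_first ch.
- move=> eta; have [g ->] := ecl_surj eta.
  rewrite Ext_map_ecl HomCf1 => /ecl_eq0 gp.
  have [i N' im MN'|f fE] := contra_chain ch (X := A) _ gp.
    by apply: in_M_acyclic => //; rewrite nm.
  by exists f; rewrite Ext_map_ecl syz_map1 HomC1f; apply/eclE.
move=> Y y MY; have [g ->] := ecl_surj y; have [f fE] := cov Y g MY.
by exists f; rewrite Ext_map_ecl HomCf1; apply/eclE.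
Qed.

(** The image of [e] is realised as the kernel of [1 - e], to which [e] corestricts. *)
Lemma split_idempotent A (e : Hom A A) : e ;; e = e -> in_M A ->
  exists B (i : Hom B A) (r : Hom A B), [/\ i ;; r = Hom1 B, r ;; i = e & in_M B].
Proof.
move=> ee MA; pose i := ker_incl (Hom1 A - e).
have e0 x : (Hom1 A - e) (e x) = 0.
  by rewrite -[LHS]/((e ;; (Hom1 A - e)) x) HomCB HomCf1 ee subrr.
pose r := ker_lift e0; have ri : r ;; i = e by exact: HomP.
have ir : i ;; r = Hom1 _.
  apply: HomP => x; apply: val_inj => /=.
  have /eqP : i x - e (i x) = 0 := ker_inclK x.
  by rewrite subr_eq0 => /eqP <-.
exists (kermod (Hom1 A - e)), i, r; split=> //; apply: (in_M_retract ir) => //.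
apply: (@fingen_epi _ _ _ r _ (in_M_fingen MA)) => y; exists (i y).
by rewrite -[LHS]/((i ;; r) y) ir.
Qed.

Lemma Ext_mapM1 k A A' B B' (f : Hom A' A) (h : Hom B B') (x : Ext k A B) :
  Ext_map k f (Hom1 B') (Ext_map k (Hom1 A) h x) = Ext_map k f h x.
Proof. by rewrite -Ext_mapM HomCf1 HomCf1. Qed.

Lemma Ext_map1M k A A' B B' (f : Hom A' A) (h : Hom B B') (x : Ext k A B) :
  Ext_map k (Hom1 A') h (Ext_map k f (Hom1 B) x) = Ext_map k f h x.
Proof. by rewrite -Ext_mapM HomC1f HomC1f. Qed.

Lemma Ext_mapMl k A A' A'' B (f : Hom A' A) (f' : Hom A'' A') (x : Ext k A B) :
  Ext_map k (f' ;; f) (Hom1 B) x = Ext_map k f' (Hom1 B) (Ext_map k f (Hom1 B) x).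
Proof. by rewrite -Ext_mapM HomC1f. Qed.

Lemma Ext_mapMr k A B B' B'' (h : Hom B B') (h' : Hom B' B'') (x : Ext k A B) :
  Ext_map k (Hom1 A) (h ;; h') x = Ext_map k (Hom1 A) h' (Ext_map k (Hom1 A) h x).
Proof. by rewrite -Ext_mapM HomC1f. Qed.

Lemma summand_cov m (A : modfg L) (F : functor (fullsub M)) : n = m.+1 -> M A ->
  direct_summand F (restrict M (Ext_cov m.+1 A)) ->
  exists B : modfg L, M B /\ funct_iso F (restrict M (Ext_cov m.+1 B)).
Proof.
case: A => A Af nm MA /summand_idempotent[pi [pp pi_iso]].
have [|Z [xi [N [iota [[Zf MZ] [Nf MN] ixi xi_pull xi_gen]]]]] := @universal_cov m A nm.
  by exists Af.
pose oZ : fullsub M := exist _ (exist _ Z Zf) MZ.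
pose oN : fullsub M := exist _ (exist _ N Nf) MN.
(* By naturality along [iota], the class [pi xi] dies in Ext^n(A, N), as [xi] does. *)
have [|f fE] := xi_pull (pi oZ xi).
  by have := @nnat _ _ _ pi oZ oN iota xi; rewrite /= ixi raddf0 => /esym.
have pif (X : fullsub M) x : pi X x = Ext_map m.+1 f (Hom1 _) x.
  have [|h ->] := xi_gen _ x; first by case: X {x} => -[X Xf] MX; exists Xf.
  have /= -> := @nnat _ _ _ pi oZ X h xi.
  by rewrite fE Ext_map1M Ext_mapM1.
have [k [e [g [ee eg [_ eF]]]]] := fitting Lart f Af.
have powE i (X : fullsub M) x : Ext_map m.+1 (Hom_pow f i.+1) (Hom1 _) x = pi X x.
  elim: i x => [|i IH] x; first by rewrite Ext_mapMl Ext_map1 pif.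
  by rewrite Ext_mapMl -pif IH pp.
(* Let F be the power of [f] in [eg]; it acts as [pi]. From [e ;; F = F], [e] fixes the image of
   [pi]; from [e = g ;; F], its action on [x] depends only on [pi x]. *)
have pie (X : fullsub M) x : Ext_map m.+1 e (Hom1 _) x = pi X x.
  have epi y : Ext_map m.+1 e (Hom1 _) (pi X y) = pi X y.
    by rewrite -(powE k) -Ext_mapMl eF.
  have eE y : Ext_map m.+1 e (Hom1 _) y = Ext_map m.+1 g (Hom1 _) (pi X y).
    by rewrite -(powE k) -Ext_mapMl -eg.
  by rewrite -epi !eE pp.
have [|B [i [r [ir ri [Bf MB]]]]] := split_idempotent ee; first by exists Af.
exists (exist _ B Bf); split=> //.
pose H := restrict M (Ext_cov m.+1 (exist _ B Bf)).
pose a (X : fullsub M) : {additive restrict M (Ext_cov m.+1 (exist _ A Af)) X -> H X} :=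
  Ext_map m.+1 i (Hom1 _).
pose b (X : fullsub M) : {additive H X -> restrict M (Ext_cov m.+1 (exist _ A Af)) X} :=
  Ext_map m.+1 r (Hom1 _).
have an (X Y : fullsub M) (h : hom X Y) x : a Y (fmap _ h x) = fmap H h (a X x).
  exact: (etrans (Ext_mapM1 i h x) (esym (Ext_map1M i h x))).
have bn (X Y : fullsub M) (h : hom X Y) x : b Y (fmap H h x) = fmap _ h (b X x).
  exact: (etrans (Ext_mapM1 r h x) (esym (Ext_map1M r h x))).
apply: (pi_iso _ (NatTrans an) (NatTrans bn)) => X x.
  by rewrite -[LHS]/(Ext_map _ i _ (Ext_map _ r _ x)) -Ext_mapMl ir Ext_map1.
by rewrite -[LHS]/(Ext_map _ r _ (Ext_map _ i _ x)) -Ext_mapMl ri pie.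
Qed.

Lemma summand_contra m (A : modfg L) (F : functor (opcat (fullsub M))) : n = m.+1 -> M A ->
  direct_summand F (restrict_op M (Ext_contra m.+1 A)) ->
  exists B : modfg L, M B /\ funct_iso F (restrict_op M (Ext_contra m.+1 B)).
Proof.
case: A => A Af nm MA /summand_idempotent[pi [pp pi_iso]].
have [|Z [xi [N [p [[Zf MZ] [Nf MN] pxi xi_push xi_gen]]]]] := @universal_contra m A nm.
  by exists Af.
pose oZ : opcat (fullsub M) := exist _ (exist _ Z Zf) MZ.
pose oN : opcat (fullsub M) := exist _ (exist _ N Nf) MN.
have [|f fE] := xi_push (pi oZ xi).
  by have := @nnat _ _ _ pi oZ oN p xi; rewrite /= pxi raddf0 => /esym.
have pif (X : opcat (fullsub M)) x : pi X x = Ext_map m.+1 (Hom1 _) f x.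
  have [|h ->] := xi_gen _ x; first by case: X {x} => -[X Xf] MX; exists Xf.
  have /= -> := @nnat _ _ _ pi oZ X h xi.
  by rewrite fE Ext_mapM1 Ext_map1M.
have [k [e [g [ee eg [Fe eF]]]]] := fitting Lart f Af.
have powE i (X : opcat (fullsub M)) x : Ext_map m.+1 (Hom1 _) (Hom_pow f i.+1) x = pi X x.
  elim: i x => [|i IH] x; first by rewrite Ext_mapMr Ext_map1 pif.
  by rewrite Ext_mapMr IH -pif pp.
(* In this variance [e = g ;; F] puts the image of [e] inside that of [pi], and [e ;; F = F] shows
   that [pi] absorbs [e]. *)
have pie (X : opcat (fullsub M)) x : Ext_map m.+1 (Hom1 _) e x = pi X x.
  have pe : pi X (Ext_map m.+1 (Hom1 _) e x) = pi X x.
    by rewrite -(powE k) -Ext_mapMr eF powE.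
  have eE : Ext_map m.+1 (Hom1 _) e x = pi X (Ext_map m.+1 (Hom1 _) g x).
    by rewrite -(powE k) -Ext_mapMr -eg.
  by rewrite -pe eE pp.
have [|B [i [r [ir ri [Bf MB]]]]] := split_idempotent ee; first by exists Af.
exists (exist _ B Bf); split=> //.
pose H := restrict_op M (Ext_contra m.+1 (exist _ B Bf)).
pose a (X : opcat (fullsub M)) : {additive restrict_op M (Ext_contra m.+1 (exist _ A Af)) X -> H X} :=
  Ext_map m.+1 (Hom1 _) r.
pose b (X : opcat (fullsub M)) : {additive H X -> restrict_op M (Ext_contra m.+1 (exist _ A Af)) X} :=
  Ext_map m.+1 (Hom1 _) i.
have an (X Y : opcat (fullsub M)) (h : hom X Y) x : a Y (fmap _ h x) = fmap H h (a X x).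
  exact: (etrans (Ext_map1M h r x) (esym (Ext_mapM1 h r x))).
have bn (X Y : opcat (fullsub M)) (h : hom X Y) x : b Y (fmap H h x) = fmap _ h (b X x).
  exact: (etrans (Ext_map1M h i x) (esym (Ext_mapM1 h i x))).
apply: (pi_iso _ (NatTrans an) (NatTrans bn)) => X x.
  by rewrite -[LHS]/(Ext_map _ _ r (Ext_map _ _ i x)) -Ext_mapMr ir Ext_map1.
by rewrite -[LHS]/(Ext_map _ _ i (Ext_map _ _ r x)) -Ext_mapMr ri pie.
Qed.

End ClusterTilting.

Theorem theorem7p8 (Lambda : pzRingType) (n : nat) (M : modfg Lambda -> Prop)
    (A : modfg Lambda) :
  artin_algebra Lambda -> (0 < n)%N -> cluster_tilting n M -> M A ->
  (forall F : functor (fullsub M),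
     direct_summand F (restrict M (Ext_cov n A)) ->
     exists B : modfg Lambda, M B /\ funct_iso F (restrict M (Ext_cov n B))) /\
  (forall F : functor (opcat (fullsub M)),
     direct_summand F (restrict_op M (Ext_contra n A)) ->
     exists B : modfg Lambda,
       M B /\ funct_iso F (restrict_op M (Ext_contra n B))).
Proof.
case: n => // n Lart _ CT MA; split=> F FG.
  exact: (summand_cov Lart CT erefl MA FG).
exact: (summand_contra Lart CT erefl MA FG).
Qed.
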